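(* Let $m\le n$ and let $k>1$ be an integer. Let $f\colon(\mathbb{R}^n,0)\to(\mathbb{R}^m,0)$ be a $C^k$ mapping defined in a neighbourhood of $0$ with $f(0)=0$, put $Z=\{x\in\mathbb{R}^n:\nu(df(x))=0\}$, and assume $0\in Z$. Let $w=j^k_Zf\in J^k_Z(n,m)$ be the $k$-$Z$-jet of which $f$ is a $C^k$-$Z$-realisation. Assume that for some constant $C>0$, $$\nu(df(x))\ge C\,\operatorname{dist}(x,Z)^{k-1}\quad\text{as } x\to 0 .$$ Then the jet $w$ is $C^0$-$Z$-sufficient in the class $C^k$. Moreover, for any $C^k$-$Z$-realisations $f_1,f_2$ of $w$, the deformation $f_1+t(f_2-f_1)$, $t\in\mathbb{R}$, is topologically trivial near $Z$ along $[0,1]$. In particular, the mappings $f_1$ and $f_2$ are isotopical near $Z$ at zero.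
   Context: Notation. $F\colon(\mathbb{R}^n,a)\to\mathbb{R}^m$ denotes a mapping defined in a neighbourhood of $a$ with values in $\mathbb{R}^m$; one writes $F\colon(\mathbb{R}^n,a)\to(\mathbb{R}^m,b)$ if $F(a)=b$. $|\cdot|$ is a norm on $\mathbb{R}^n$, $\operatorname{dist}(x,V)$ is the distance of $x$ to $V\subset\mathbb{R}^n$ (with $\operatorname{dist}(x,\emptyset)=1$). $df(x)\in L(\mathbb{R}^n,\mathbb{R}^m)$ is the differential of $f$ at $x$; the set $Z$ consists of points $x$ of the domain of $f$. An inequality ''as $x\to0$'' means that it holds for all $x$ in some neighbourhood of $0$. Rabier function. For real Banach spaces $X,Y$ and a continuous linear map $A\in L(X,Y)$ with adjoint $A^*\in L(Y',X')$ ($X',Y'$ the dual spaces), $\nu(A)=\inf\{\|A^*\varphi\|:\varphi\in Y',\ \|\varphi\|=1\}$. $k$-$Z$-jets. $\mathcal{C}^k_0(n,m)$ is the set of $C^k$ mappings $(\mathbb{R}^n,0)\to\mathbb{R}^m$. For a $C^k$ mapping $F$ near $a$, $j^kF(a)$ is the $k$-jet of $F$ at $a$, so $j^kF(a)=j^kG(a)$ means that the components of $F$ and $G$ have the same Taylor polynomials of degree $k$ at $a$. Let $Z\subset\mathbb{R}^n$ with $0\in Z$ and let $k$ be a positive integer. A $k$-$Z$-jet is an equivalence class $w\subset\mathcal{C}^k_0(n,m)$ of the relation: $F\sim G$ iff for some neighbourhood $U$ of the origin $j^kF(a)=j^kG(a)$ for all $a\in Z\cap U$. Elements $F\in w$ are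 called $C^k$-$Z$-realisations of $w$, and one writes $w=j^k_ZF$; $J^k_Z(n,m)$ is the set of all such jets. Sufficiency. A jet $w\in J^k_Z(n,m)$ is $C^0$-$Z$-sufficient in the class $C^k$ if for any two of its $C^k$-$Z$-realisations $f,g$ there is a $C^0$ diffeomorphism (i.e. homeomorphism) germ $\varphi\colon(\mathbb{R}^n,0)\to(\mathbb{R}^n,0)$ such that, in some neighbourhood $U$ of $0$, $f\circ\varphi=g$ and $\varphi(x)=x$ for $x\in Z\cap U$. Isotopy. Let $\Omega\subset\mathbb{R}^n$ be a neighbourhood of $0$ and $0\in Z\subset\mathbb{R}^n$. A continuous mapping $H\colon\Omega\times[0,1]\to\mathbb{R}^n$, with $H_t(x)=H(x,t)$, is an isotopy near $Z$ at zero if (a) $H_0(x)=x$ for $x\in\Omega$, and $H_t(x)=x$ for $t\in[0,1]$, $x\in\Omega\cap Z$; (b) for every $t\in[0,1]$ the mapping $H_t$ is a homeomorphism onto $H_t(\Omega)$. Mappings $f\colon\Omega_1\to\mathbb{R}^m$ and $g\colon\Omega_2\to\mathbb{R}^m$, where $\Omega_1,\Omega_2$ are neighbourhoods of $0\in\mathbb{R}^n$, are isotopical near $Z$ at zero if there is an isotopy near $Z$ at zero $H\colon\Omega\times[0,1]\to\mathbb{R}^n$, $\Omega\subset\Omega_1\cap\Omega_2$, with $f(H_1(x))=g(x)$ for $x\in\Omega$. For $f\colon\Omega_1\to\mathbb{R}^m$ and $h\colon\Omega_3\to\mathbb{R}^m$, with $\Omega_1,\Omega_3$ neighbourhoods of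 $0\in\mathbb{R}^n$, the deformation $f+th$ is topologically trivial near $Z$ along $[0,1]$ if there is an isotopy near $Z$ at zero $H\colon\Omega\times[0,1]\to\mathbb{R}^n$, $\Omega\subset\Omega_1\cap\Omega_3$, such that $f(H(x,t))+t\,h(H(x,t))$ is defined for all $(x,t)\in\Omega\times[0,1]$ and does not depend on $t\in[0,1]$. *)

(* Defs.v *)
(* R^n is 'rV[R]_n for an arbitrary R : realType (MathComp-Analysis). *)
From HB Require Import structures.
From mathcomp Require Import all_boot all_order all_algebra.
From mathcomp Require Import all_classical all_reals all_analysis.

Set Implicit Arguments.
Unset Strict Implicit.
Unset Printing Implicit Defensive.

Import Order.TTheory GRing.Theory Num.Theory.
Import numFieldNormedType.Exports.

Local Open Scope classical_set_scope.
Local Open Scope ring_scope.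

(* The norms on R^n and R^m are arbitrary.  The library's norm on 'rV[R]_n
   (the sup norm) is used only through the topology, the differential and the
   directional derivatives, none of which depends on the choice of a norm. *)
Record is_norm (R : realType) (n : nat) (N : 'rV[R]_n -> R) : Prop := IsNorm {
  is_norm_triangle : forall x y, N (x + y) <= N x + N y ;
  is_norm_scale : forall (c : R) x, N (c *: x) = `|c| * N x ;
  is_norm_eq0 : forall x, N x = 0 -> x = 0 }.

Definition dist (R : realType) (n : nat) (N : 'rV[R]_n -> R)
    (x : 'rV[R]_n) (V : set 'rV[R]_n) : R :=
  if `[< V = set0 >] then 1 else inf [set N (x - y) | y in V].

Definition dual_norm (R : realType) (n : nat) (N : 'rV[R]_n -> R)
    (phi : 'rV[R]_n -> R) : R :=
  sup [set `|phi x| | x in [set x | N x <= 1]].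

(* The adjoint of A sends phi to phi \o A; in finite dimension every linear
   form is continuous, so the dual of 'rV[R]_m is {scalar 'rV[R]_m}. *)
Definition rabier (R : realType) (n m : nat)
    (Nn : 'rV[R]_n -> R) (Nm : 'rV[R]_m -> R)
    (A : {linear 'rV[R]_n -> 'rV[R]_m}) : R :=
  inf [set dual_norm Nn (phi \o A) |
        phi in [set phi : {scalar 'rV[R]_m} | dual_norm Nm phi = 1]].

(* For open U: f is of class C^(k+1) on U iff it is differentiable on U and
   x |-> df(x) v is of class C^k on U for every v.  As R^n is finite
   dimensional, this is the C^k regularity of x |-> df(x) in L(R^n, R^m). *)
Fixpoint class_C (R : realType) (n m k : nat) (U : set 'rV[R]_n)
    (f : 'rV[R]_n -> 'rV[R]_m) : Prop :=
  match k with
  | 0 => forall x, U x -> {for x, continuous f}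
  | k'.+1 => (forall x, U x -> differentiable f x) /\
             (forall v, class_C k' U (fun x => 'd f x v))
  end.

(* C^k mappings (R^n,0) -> (R^m,0), with their domain; the values of the total
   function Ck0_fun outside Ck0_dom are irrelevant. *)
Record Ck0 (R : realType) (k n m : nat) := MkCk0 {
  Ck0_dom : set 'rV[R]_n ;
  Ck0_fun :> 'rV[R]_n -> 'rV[R]_m ;
  Ck0_dom_open : open Ck0_dom ;
  Ck0_dom0 : Ck0_dom 0 ;
  Ck0_class : class_C k Ck0_dom Ck0_fun ;
  Ck0_fun0 : Ck0_fun 0 = 0 }.

(* The k-jet of F at a is the Taylor polynomial of degree k, as a function of
   the increment h: sum over j <= k of d^jF(a)(h,...,h) / j!. *)
Definition jet (R : realType) (n m k : nat) (F : 'rV[R]_n -> 'rV[R]_m)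
    (a : 'rV[R]_n) : 'rV[R]_n -> 'rV[R]_m :=
  fun h => \sum_(j < k.+1)
    (j`!%:R : R)^-1 *: iter j (fun G x => 'D_h G x) F a.

Definition same_Zjet (R : realType) (k n m : nat) (Z : set 'rV[R]_n)
    (F G : Ck0 R k n m) : Prop :=
  \forall a \near (0 : 'rV[R]_n), Z a -> jet k F a = jet k G a.

(* j^k_Z F, as an equivalence class; its elements are its realisations. *)
Definition Zjet (R : realType) (k n m : nat) (Z : set 'rV[R]_n)
    (F : Ck0 R k n m) : set (Ck0 R k n m) :=
  [set G | same_Zjet Z F G].

Definition homeo_onto_image (R : realType) (n : nat) (U : set 'rV[R]_n)
    (phi : 'rV[R]_n -> 'rV[R]_n) : Prop :=
  {within U, continuous phi} /\
  exists psi : 'rV[R]_n -> 'rV[R]_n,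
    (forall x, U x -> psi (phi x) = x) /\
    {within phi @` U, continuous psi}.

Definition homeo_germ0 (R : realType) (n : nat)
    (phi : 'rV[R]_n -> 'rV[R]_n) : Prop :=
  phi 0 = 0 /\
  exists U : set 'rV[R]_n,
    [/\ open U, U 0, open (phi @` U) & homeo_onto_image U phi].

Definition C0_Z_sufficient (R : realType) (k n m : nat) (Z : set 'rV[R]_n)
    (w : set (Ck0 R k n m)) : Prop :=
  forall f g : Ck0 R k n m, w f -> w g ->
    exists phi : 'rV[R]_n -> 'rV[R]_n,
      homeo_germ0 phi /\
      exists U : set 'rV[R]_n, nbhs (0 : 'rV[R]_n) U /\
        (forall x, U x ->
          [/\ Ck0_dom f (phi x), Ck0_dom g x & f (phi x) = g x]) /\
        (forall x, (Z `&` U) x -> phi x = x).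

Definition isotopy_near (R : realType) (n : nat) (Z Omega : set 'rV[R]_n)
    (H : 'rV[R]_n * R -> 'rV[R]_n) : Prop :=
  [/\ nbhs (0 : 'rV[R]_n) Omega,
      {within Omega `*` `[0, 1]%classic, continuous H},
      (forall x, Omega x -> H (x, 0) = x),
      (forall t x, 0 <= t <= 1 -> (Omega `&` Z) x -> H (x, t) = x)
    & (forall t, 0 <= t <= 1 ->
         homeo_onto_image Omega (fun x => H (x, t)))].

(* f : D1 -> R^m and g : D2 -> R^m *)
Definition isotopical_near (R : realType) (n m : nat) (Z : set 'rV[R]_n)
    (D1 : set 'rV[R]_n) (f : 'rV[R]_n -> 'rV[R]_m)
    (D2 : set 'rV[R]_n) (g : 'rV[R]_n -> 'rV[R]_m) : Prop :=
  exists (Omega : set 'rV[R]_n) (H : 'rV[R]_n * R -> 'rV[R]_n),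
    [/\ isotopy_near Z Omega H,
        Omega `<=` D1 `&` D2
      & forall x, Omega x -> D1 (H (x, 1)) /\ f (H (x, 1)) = g x].

(* The deformation f + t h, with f : D1 -> R^m and h : D3 -> R^m *)
Definition topologically_trivial_near (R : realType) (n m : nat)
    (Z : set 'rV[R]_n)
    (D1 : set 'rV[R]_n) (f : 'rV[R]_n -> 'rV[R]_m)
    (D3 : set 'rV[R]_n) (h : 'rV[R]_n -> 'rV[R]_m) : Prop :=
  exists (Omega : set 'rV[R]_n) (H : 'rV[R]_n * R -> 'rV[R]_n),
    [/\ isotopy_near Z Omega H,
        Omega `<=` D1 `&` D3,
        (forall x t, Omega x -> 0 <= t <= 1 -> (D1 `&` D3) (H (x, t)))
      & (forall x s t, Omega x -> 0 <= s <= 1 -> 0 <= t <= 1 ->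
           f (H (x, s)) + s *: h (H (x, s)) =
           f (H (x, t)) + t *: h (H (x, t)))].

(* Main.v *)
Require Import Defs.
From HB Require Import structures.
From mathcomp Require Import all_boot all_order all_algebra.
From mathcomp Require Import all_classical all_reals all_analysis.
From mathcomp Require Import perm.
From mathcomp Require Import ring lra.
Import Order.TTheory GRing.Theory Num.Theory.
Import numFieldNormedType.Exports.
Local Open Scope classical_set_scope.
Local Open Scope ring_scope.
Set Implicit Arguments.
Unset Strict Implicit.
Unset Printing Implicit Defensive.

(** The proof integrates the vector field of Kuo. Write [d x] for the distance
    from [x] to [Z], let [f1] and [f2] realise the jet of [f], and put
    [h := f2 - f1].

    Along [Z] the [k]-jets of [f1], [f2] and [f] agree. Taylor's formula at a
    point of [Z] near [x] then gives [h x = o(d x ^ k)] ([flat_value]) and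
    [dh(x) = o(d x ^ (k - 1))], [d(f1 - f)(x) = o(d x ^ (k - 1))]
    ([flat_derivative]). The Rabier function bounds below the transpose of a
    linear map ([rabier_lower]); so the hypothesis on [f] passes, with a smaller
    constant, to all the maps [d(f1 + t h)(x)] with [0 <= t <= 1]. Off [Z] these
    are onto, and the least solution [V (x, t)] of
    [d(f1 + t h)(x) V = - h x] has norm at most a constant times
    [`|h x| / d x ^ (k - 1)], that is [o(d x)] ([gram_solution]).

    Extended by [0] where [d] vanishes, and cut off away from the origin, [V] is a
    continuous field which is locally Lipschitz where [d] is positive, because
    [k > 1]. It is in general not Lipschitz near [Z]; but since, close to the
    origin, its norm is at most [d x / 4], a trajectory keeps a distance from [Z] comparable to its
    initial one. Hence a trajectory never meets [Z] unless it is constant, and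
    away from [Z] it is a trajectory of a globally Lipschitz field, to which
    Picard's theorem and Gronwall's inequality apply; near [Z] the flow is
    continuous because points at distance [d x] from [Z] move by at most
    [d x / 2] ([tame_flow]). Following trajectories from time [0] to time [t] is
    a homeomorphism, its inverse being given by the trajectories followed
    backwards. The choice of [V] makes [f1 + t h] constant along trajectories
    ([deformation_isotopy]).

    All estimates are made in the sup norm, to which the given norms are
    equivalent. *)

(** * Mean value inequality for curves *)

Lemma coord_le_norm {R : realType} {m n} (x : 'M[R]_(m, n)) i j :
  `|x i j| <= `|x|.
Proof.
rewrite [leRHS]/Num.Def.normr /= mx_normrE.
exact: (le_bigmax _ (fun i => `|x i.1 i.2|) (i, j)).
Qed.

Lemma norm_le_coord {R : realType} {m n} (x : 'M[R]_(m, n)) M :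
  0 <= M -> (forall i j, `|x i j| <= M) -> `|x| <= M.
Proof.
move=> M0 xM; rewrite [leLHS]/Num.Def.normr /= mx_normrE.
by apply: bigmax_le => // -[i j] _; exact: xM.
Qed.

Lemma is_derive_coord {R : realType} {m n} (u : R -> 'M[R]_(m, n)) du t v i j :
  is_derive t v u du -> is_derive t v (fun s => u s i j) (du i j).
Proof.
move=> [uD uE]; apply: DeriveDef; first exact: (derivable_mxP _ _ _).1.
by rewrite -uE derive_mx// mxE.
Qed.

Lemma is_derive_mx {R : realType} {m n} (u : R -> 'M[R]_(m, n)) (du : 'M[R]_(m, n)) t v :
  (forall i j, is_derive t v (fun s => u s i j) (du i j)) ->
  is_derive t v u du.
Proof.
move=> uD; have uD' : derivable u t v by apply/derivable_mxP => i j; exact: ex_derive.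
apply: DeriveDef => //; rewrite derive_mx//; apply/matrixP => i j.
by rewrite mxE; have [_ ->] := uD i j.
Qed.

Lemma is_derive1_continuous {R : realType} {V : normedModType R} (u : R -> V) (du : V) (t : R) :
  is_derive t 1 u du -> {for t, continuous u}.
Proof. by move=> [uD _]; apply/differentiable_continuous/derivable1_diffP. Qed.

(** Coordinatewise, [psi - u] and [psi + u] are nondecreasing; the norm being the
    sup norm, no loss occurs when the coordinates are put together. *)
Lemma mean_value_inequality {R : realType} {n} (u du : R -> 'rV[R]_n)
    (psi dpsi : R -> R) (a b : R) : a <= b ->
  (forall t, a <= t <= b -> is_derive t 1 u (du t)) ->
  (forall t, a <= t <= b -> is_derive t 1 psi (dpsi t)) ->
  (forall t, a <= t <= b -> `|du t| <= dpsi t) ->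
  `|u b - u a| <= psi b - psi a.
Proof.
move=> ab uD psiD dule.
have psi_ge (g dg : R -> R) : (forall t, a <= t <= b -> is_derive t 1 g (dg t)) ->
    (forall t, a <= t <= b -> 0 <= dg t) -> g a <= g b.
  move=> gD dg0; rewrite -subr_ge0.
  have [t /andP[]||c] := @MVT_segment R g dg a b ab.
  - by rewrite !bnd_simp => /ltW at_ /ltW tb; apply: gD; rewrite at_.
  - apply/continuous_in_subspaceT => t; rewrite inE /= in_itv /= => tab.
    exact: is_derive1_continuous (gD _ tab).
  by rewrite in_itv /= => cab ->; rewrite mulr_ge0 ?dg0// subr_ge0.
have psi_le : psi a <= psi b.
  apply: (psi_ge _ dpsi) => // t tab; exact: le_trans (dule _ tab).
apply: norm_le_coord; first by rewrite subr_ge0.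
move=> i j; rewrite !mxE ler_norml; apply/andP; split.
- suff ? : psi a + u a i j <= psi b + u b i j by lra.
  apply: (psi_ge (psi + (fun t => u t i j)) (fun t => dpsi t + du t i j)) => t tab.
    by apply: is_deriveD; [exact: psiD|apply: is_derive_coord; exact: uD].
  have := le_trans (coord_le_norm _ i j) (dule _ tab).
  by rewrite ler_norml => /andP[? ?] /=; lra.
- suff ? : psi a - u a i j <= psi b - u b i j by lra.
  apply: (psi_ge (psi - (fun t => u t i j)) (fun t => dpsi t - du t i j)) => t tab.
    by apply: is_deriveB; [exact: psiD|apply: is_derive_coord; exact: uD].
  have := le_trans (coord_le_norm _ i j) (dule _ tab).
  by rewrite ler_norml => /andP[? ?] /=; lra.
Qed.

(** * Antiderivatives and a Gronwall inequality *)

Lemma antiderivative_exists {R : realType} (g : R -> R) : continuous g ->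
  exists G : R -> R, forall t : R, 0 <= t <= 1 -> is_derive t 1 G (g t).
Proof.
move=> gc; exists (fun x => \int[lebesgue_measure]_(t in `[-1, x]) g t)%R.
move=> t /andP[t0 t1].
have [] := @continuous_FTC1_closed R g (-1) t 2.
- lra.
- apply: continuous_compact_integrable; first exact: segment_compact.
  exact: continuous_subspaceT.
- lra.
- exact: gc.
by move=> GD GE; apply: DeriveDef => //; rewrite -derive1E.
Qed.

Lemma antiderivative_rV {R : realType} {n} (g : R -> 'rV[R]_n) (t0 : R) (x0 : 'rV[R]_n) :
  continuous g ->
  exists G : R -> 'rV[R]_n, G t0 = x0 /\
    forall t : R, 0 <= t <= 1 -> is_derive t 1 G (g t).
Proof.
move=> gc.
have /choice[G GD] j : exists G : R -> R,
    forall t : R, 0 <= t <= 1 -> is_derive t 1 G (g t ord0 j).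
  apply: antiderivative_exists => t.
  exact: (@continuous_comp _ _ _ g (fun M : 'rV[R]_n => M ord0 j) t (gc t)
            (@coord_continuous _ _ _ _ _ _)).
exists (fun t => x0 + \row_j (G j t - G j t0)); split.
  by apply/rowP => j; rewrite !mxE subrr addr0.
move=> t t01; apply: is_derive_mx => i j; rewrite ord1.
have -> : (fun s => (x0 + \row_j0 (G j0 s - G j0 t0)) ord0 j) =
    cst (x0 ord0 j) + (G j - cst (G j t0)).
  by apply/funext => s; rewrite !mxE.
have -> : g t ord0 j = 0 + (g t ord0 j - 0) by rewrite subr0 add0r.
by have ? := GD j t t01; apply: is_deriveD.
Qed.

Lemma is_derive_expR_affine {R : realType} (c k t0 s : R) :
  is_derive s 1 (fun s => c * expR (k * (s - t0))) (c * k * expR (k * (s - t0))).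
Proof.
have affD : is_derive s 1 (fun s => k * (s - t0)) k.
  have -> : (fun s => k * (s - t0)) = k *: (id - cst t0) by apply/funext.
  by apply: is_derive_eq; rewrite subr0 /GRing.scale/= mulr1.
have eD := @is_derive1_comp R expR _ s _ _ (is_derive_expR (k * (s - t0))) affD.
have -> : (fun s => c * expR (k * (s - t0))) =
  c *: (expR \o (fun s => k * (s - t0))) by apply/funext.
apply: is_derive_eq; rewrite /GRing.scale/=; ring.
Qed.

(** The weight [expR (2 * K * `|t - t0|)] grows so fast that a bound on [du] with
    factor [K * B] yields a bound on [u] with factor [B / 2]. This gain of [2],
    whatever [K], makes Picard's iteration and Gronwall's inequality close on the
    whole of [[0, 1]] at once. *)
Lemma weighted_growth {R : realType} {n} (u du : R -> 'rV[R]_n) (t0 K B : R) :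
  0 <= t0 <= 1 ->
  (forall t : R, 0 <= t <= 1 -> is_derive t 1 u (du t)) ->
  (forall t : R, 0 <= t <= 1 -> `|du t| <= K * B * expR (2 * K * `|t - t0|)) ->
  forall t : R, 0 <= t <= 1 ->
    `|u t - u t0| <= B / 2 * expR (2 * K * `|t - t0|) - B / 2.
Proof.
move=> t001 uD duB t t01.
have [t0t|tt0] := leP t0 t.
- have := @mean_value_inequality R n u du
    (fun s => B / 2 * expR (2 * K * (s - t0)))
    (fun s => B / 2 * (2 * K) * expR (2 * K * (s - t0))) t0 t t0t.
  rewrite subrr mulr0 expR0 mulr1 ger0_norm ?subr_ge0//; apply=> s /andP[s0 st].
  + by apply: uD; lra.
  + exact: is_derive_expR_affine.
  + have := duB s; rewrite ger0_norm ?subr_ge0// => duBs.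
    apply: (le_trans (duBs _)); first lra.
    by rewrite ler_pM2r ?expR_gt0//; lra.
- pose psi s := - (B / 2) * expR (- (2 * K) * (s - t0)).
  have -> : B / 2 * expR (2 * K * `|t - t0|) - B / 2 = psi t0 - psi t.
    rewrite /psi subrr mulr0 expR0 mulr1 ltr0_norm ?subr_lt0// mulrN mulNr.
    by rewrite -mulNr; ring.
  rewrite distrC; apply: (@mean_value_inequality R n u du psi
    (fun s => - (B / 2) * - (2 * K) * expR (- (2 * K) * (s - t0))));
    [exact: ltW|..] => s /andP[ts st0].
  + by apply: uD; lra.
  + exact: is_derive_expR_affine.
  + have := duB s; rewrite ler0_norm ?subr_le0// => duBs.
    apply: (le_trans (duBs _)); first lra.
    by rewrite mulrN -mulNr ler_pM2r ?expR_gt0//; lra.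
Qed.

(** A form of Gronwall's inequality, valid in both time directions, obtained by
    maximizing the weighted norm. *)
Lemma gronwall {R : realType} {n} (u du : R -> 'rV[R]_n) (t0 K : R) :
  0 <= t0 <= 1 -> 0 <= K ->
  (forall t : R, 0 <= t <= 1 -> is_derive t 1 u (du t)) ->
  (forall t : R, 0 <= t <= 1 -> `|du t| <= K * `|u t|) ->
  forall t : R, 0 <= t <= 1 -> `|u t| <= 2 * `|u t0| * expR (2 * K * `|t - t0|).
Proof.
move=> t001 K0 uD duK.
set e := fun t : R => expR (2 * K * `|t - t0|).
have e_gt0 t : 0 < e t by exact: expR_gt0.
have e_ge1 t : 1 <= e t.
  by rewrite -expR0 ler_expR !mulr_ge0.
have ec : continuous e.
  move=> t; apply: (@continuous_comp _ _ _ (fun t : R => 2 * K * `|t - t0|) expR);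
    last exact: continuous_expR.
  apply: continuousM; first exact: cvg_cst.
  apply: (@continuous_comp _ _ _ (fun t : R => t - t0) Num.norm);
    last exact: norm_continuous.
  by apply: continuousB; [exact: cvg_id|exact: cvg_cst].
have [c c01 Smax] : exists2 c, 0 <= c <= 1 &
    forall t : R, 0 <= t <= 1 -> `|u t| / e t <= `|u c| / e c.
  have [c|c c01 cmax] := @EVT_max R (fun t => `|u t| / e t) 0 1 ler01.
    apply/continuous_in_subspaceT => t; rewrite inE /= in_itv /= => t01.
    apply: (@cvgM R _ (nbhs t) _ (fun t => `|u t|) (fun t => (e t)^-1));
      last by apply: cvgV; [rewrite gt_eqF|exact: ec].
    apply: (@continuous_comp _ _ _ u Num.norm); last exact: norm_continuous.
    exact: is_derive1_continuous (uD _ t01).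
  by exists c; [move: c01; rewrite in_itv|move=> t t01; apply: cmax; rewrite in_itv].
set S := _ / _ in Smax.
have uS t : 0 <= t <= 1 -> `|u t| <= S * e t.
  by move=> /Smax; rewrite ler_pdivrMr.
have uc : `|u c| = S * e c by rewrite /S divfK// gt_eqF.
have : `|u c - u t0| <= S / 2 * e c - S / 2.
  apply: (weighted_growth t001 uD _ c01) => t t01.
  by rewrite -mulrA (le_trans (duK _ t01))// ler_wpM2l// uS.
have := ler_normD (u c - u t0) (u t0); rewrite subrK uc => h1 h2.
have S0 : 0 <= S by rewrite divr_ge0// ltW.
have SB : S <= 2 * `|u t0|.
  have : S * 1 <= S * e c by rewrite ler_wpM2l.
  by rewrite mulr1; lra.
by move=> t t01; apply: (le_trans (uS _ t01)); rewrite ler_wpM2r// ltW.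
Qed.

(** * Picard iteration *)

Definition unit_clamp {R : realType} (t : R) : R := Num.max 0 (Num.min 1 t).

Lemma unit_clamp_itv {R : realType} (t : R) : 0 <= unit_clamp t <= 1.
Proof. by rewrite /unit_clamp le_max lexx ge_max ler01 ge_min lexx. Qed.

Lemma unit_clamp_id {R : realType} (t : R) : 0 <= t <= 1 -> unit_clamp t = t.
Proof. by move=> /andP[t0 t1]; rewrite /unit_clamp min_r// max_r. Qed.

Lemma unit_clamp_lipschitz {R : realType} (s t : R) :
  `|unit_clamp s - unit_clamp t| <= `|s - t|.
Proof.
have := ler_norm (s - t); have := ler_norm (- (s - t)); rewrite normrN.
move=> st ts; rewrite /unit_clamp.
case: (lerP 1 s) => s1; case: (lerP 1 t) => t1.
all: rewrite ?(max_r ler01) ?subrr ?normr0//.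
all: case: (lerP 0 s) => ?; case: (lerP 0 t) => ?.
all: by rewrite ?subrr ?normr0// ler_norml; apply/andP; split; lra.
Qed.

Lemma unit_clamp_continuous {R : realType} : continuous (@unit_clamp R).
Proof.
move=> t; apply/cvgrPdist_le => e e0; near=> s.
apply: (le_trans (unit_clamp_lipschitz _ _)).
near: s; exact: cvgr_dist_le.
Unshelve. all: by end_near. Qed.

Lemma cvg_half_increments {R : realType} {n} (v : nat -> 'rV[R]_n) (A : R) :
  (forall i, `|v i.+1 - v i| <= A / 2 ^+ i) ->
  exists l, forall i, `|l - v i| <= 2 * A / 2 ^+ i.
Proof.
move=> vA.
have A0 : 0 <= A by have := vA 0%N; rewrite expr0 divr1; exact: le_trans.
have vij i j : `|v (i + j)%N - v i| <= 2 * A / 2 ^+ i - 2 * A / 2 ^+ (i + j).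
  elim: j => [|j IH]; first by rewrite addn0 !subrr normr0.
  rewrite addnS -(subrKA (v (i + j)%N)) (le_trans (ler_normD _ _))//.
  have := lerD (vA (i + j)%N) IH; rewrite exprS invfM.
  set q := (2 ^+ (i + j))^-1; lra.
have vij' i j : (i <= j)%N -> `|v j - v i| <= 2 * A / 2 ^+ i.
  move=> ij; rewrite -(subnKC ij); apply: (le_trans (vij _ _)).
  by rewrite gerBl divr_ge0 ?mulr_ge0// exprn_ge0.
have vcvg : cvg (v @ \oo).
  apply/cauchy_cvgP/cauchy_exP => e e0.
  have [N _ Ne] : \forall i \near \oo, 2 * A / 2 ^+ i < e.
    have := @cvg_geometric R (2 * A) (2^-1) _.
    rewrite ger0_norm ?invr_ge0// invf_lt1// ltr1n => /(_ isT).
    move=> /cvgr_lt /(_ e e0); apply: filterS => i.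
    by rewrite /geometric /= exprVn.
  exists (v N); apply: filterS (nbhs_infty_ge N) => j /= Nj.
  rewrite -ball_normE /= distrC (le_lt_trans (vij' _ _ Nj))//.
  exact: (Ne N (leqnn N)).
exists (lim (v @ \oo)) => i.
have lv : (fun j => `|v j - v i|) @ \oo --> `|lim (v @ \oo) - v i|.
  by apply: cvg_norm; apply: cvgB => //; exact: cvg_cst.
apply: (@closed_cvg _ _ _ _ (fun j => `|v j - v i|)
  (fun x : R => x <= 2 * A / 2 ^+ i) _ _ _ lv); first exact: closed_le.
by apply: filterS (nbhs_infty_ge i) => j /= ij; exact: vij'.
Qed.

(** Picard iteration on the whole of [[0, 1]]: by [weighted_growth] each step
    halves the distance of two curves measured in the weighted sup norm, whatever
    the Lipschitz constant. Time is clamped in the iterates so that they stay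
    continuous on the real line. *)
Lemma picard {R : realType} {n} (Y : 'rV[R]_n * R -> 'rV[R]_n) (K : R)
    (t0 : R) (x0 : 'rV[R]_n) :
  continuous Y -> 0 <= K -> 0 <= t0 <= 1 ->
  (forall (t : R) x y, 0 <= t <= 1 -> `|Y (x, t) - Y (y, t)| <= K * `|x - y|) ->
  exists u : R -> 'rV[R]_n, u t0 = x0 /\
    forall t : R, 0 <= t <= 1 -> is_derive t 1 u (Y (u t, t)).
Proof.
move=> Yc K0 t001 YK.
have /choice[T TP] (v : R -> 'rV[R]_n) : exists w : R -> 'rV[R]_n, continuous v ->
    w t0 = x0 /\ forall t : R, 0 <= t <= 1 -> is_derive t 1 w (Y (v t, t)).
  have [vc|] := pselect (continuous v); last by exists (cst 0).
  have [|w [w0 wD]] := @antiderivative_rV R n (fun t => Y (v t, t)) t0 x0.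
    move=> t; apply: (@continuous_comp _ _ _ (fun t => (v t, t)) Y); last exact: Yc.
    exact: (@cvg_pair _ _ _ (nbhs t) (nbhs (v t)) (nbhs t) _ _ _ v id (vc t) cvg_id).
  by exists w.
have Tcl v : continuous v -> continuous (T v \o unit_clamp).
  move=> vc t; apply: continuous_comp; first exact: unit_clamp_continuous.
  have [_ /(_ _ (unit_clamp_itv t))] := TP _ vc.
  exact: is_derive1_continuous.
pose e (t : R) := expR (2 * K * `|t - t0|).
have contr v w B : continuous v -> continuous w -> 0 <= B ->
    (forall t : R, 0 <= t <= 1 -> `|v t - w t| <= B * e t) ->
    forall t : R, 0 <= t <= 1 -> `|T v t - T w t| <= B / 2 * e t.
  move=> vc wc B0 vwB t t01.
  have [Tv0 TvD] := TP _ vc; have [Tw0 TwD] := TP _ wc.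
  have := @weighted_growth R n (T v - T w) (fun t => Y (v t, t) - Y (w t, t))
    t0 K B t001 _ _ t t01.
  rewrite -[(T v - T w) t]/(T v t - T w t) -[(T v - T w) t0]/(T v t0 - T w t0).
  rewrite Tv0 Tw0 subrr subr0 => h.
  rewrite (le_trans (h _ _))//; last by rewrite gerBl divr_ge0.
  - by move=> s s01; have ? := TvD s s01; have ? := TwD s s01; apply: is_deriveB.
  - move=> s s01; apply: (le_trans (YK _ _ _ s01)).
    by rewrite -mulrA ler_wpM2l// vwB.
pose v i : R -> 'rV[R]_n := iter i (fun v => T v \o unit_clamp) (cst x0).
have vc i : continuous (v i).
  by elim: i => [|i IH]; [move=> ?; exact: cvg_cst|exact: Tcl].
have e_ge1 t : 1 <= e t by rewrite /e -expR0 ler_expR !mulr_ge0.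
have [B0 v10] : exists B0, forall t : R, 0 <= t <= 1 -> `|v 1%N t - v 0%N t| <= B0.
  have [c|c c01 cmax] := @EVT_max R (fun t => `|v 1%N t - v 0%N t|) 0 1 ler01.
    apply/continuous_subspaceT => t.
    apply: (@continuous_comp _ _ _ (v 1%N - v 0%N) Num.norm); last exact: norm_continuous.
    by apply: continuousB; exact: vc.
  by exists `|v 1%N c - v 0%N c| => t t01; apply: cmax; rewrite in_itv.
have B00 : 0 <= B0 by apply: le_trans (v10 0 _); rewrite ?lexx ?ler01 ?normr_ge0.
have step i (t : R) : 0 <= t <= 1 -> `|v i.+1 t - v i t| <= B0 / 2 ^+ i * e t.
  elim: i t => [|i IH] t t01.
    by rewrite expr0 divr1 (le_trans (v10 _ t01))// ler_peMr.
  have := contr _ _ (B0 / 2 ^+ i) (vc i.+1) (vc i) _ IH t t01.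
  rewrite divr_ge0 ?exprn_ge0// => /(_ isT).
  by rewrite /= unit_clamp_id// exprSr invfM mulrA.
pose A := B0 * expR (2 * K).
have eA (t : R) : 0 <= t <= 1 -> e t <= expR (2 * K).
  move=> t01; rewrite /e ler_expR ler_piMr ?mulr_ge0//.
  by rewrite ler_norml; apply/andP; split; lra.
have vcl i t : v i (unit_clamp t) = v i t.
  by case: i => [//|i] /=; rewrite (unit_clamp_id (unit_clamp_itv t)).
have vA i t : `|v i.+1 t - v i t| <= A / 2 ^+ i.
  rewrite -!(vcl _ t) (le_trans (step _ _ (unit_clamp_itv t)))//.
  rewrite /A [leRHS]mulrAC ler_wpM2l ?eA ?unit_clamp_itv// divr_ge0// exprn_ge0//.
have /choice[u uP] t : exists l, forall i, `|l - v i t| <= 2 * A / 2 ^+ i.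
  exact: (cvg_half_increments (fun i => vA i t)).
have half0 (c : R) : c / 2 ^+ i @[i --> \oo] --> 0.
  have := @cvg_geometric R c (2^-1) _.
  rewrite ger0_norm ?invr_ge0// invf_lt1// ltr1n => /(_ isT).
  by rewrite /geometric /=; under eq_fun do rewrite exprVn.
have uc : continuous u.
  move=> t; apply/cvgrPdist_le => eps eps0.
  have eps30 : 0 < eps / 3 by rewrite divr_gt0.
  have [i _ /(_ i (leqnn _)) /= iP] : \forall i \near \oo, 2 * A / 2 ^+ i < eps / 3.
    by have /cvgr_lt := half0 (2 * A); exact.
  near=> s.
  have : `|v i t - v i s| <= eps / 3.
    near: s; have /cvgrPdist_le := vc i t; exact.
  have := uP t i; have := uP s i; rewrite [`|u s - _|]distrC => us ut vts.
  have -> : u t - u s = (u t - v i t) + ((v i t - v i s) + (v i s - u s)).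
    by rewrite !subrKA.
  rewrite (le_trans (ler_normD _ _))//.
  have := ler_normD (v i t - v i s) (v i s - u s); lra.
have [Tu0 TuD] := TP _ uc.
have uE (t : R) : 0 <= t <= 1 -> T u t = u t.
  move=> t01; apply/eqP; rewrite -subr_eq0 -normr_le0.
  apply/ler_addgt0Pl => eps eps0; rewrite addr0.
  have [i _ /(_ i (leqnn _)) /= iP] :
      \forall i \near \oo, (A * expR (2 * K) + A) / 2 ^+ i < eps.
    by have /cvgr_lt := half0 (A * expR (2 * K) + A); exact.
  apply: le_trans (ltW iP).
  have A0 : 0 <= A by rewrite mulr_ge0 ?expR_ge0.
  have := contr u (v i) (2 * A / 2 ^+ i) uc (vc i) _ _ t t01.
  rewrite divr_ge0 ?mulr_ge0 ?exprn_ge0// => /(_ isT) h.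
  have {}h : `|T u t - v i.+1 t| <= A / 2 ^+ i * expR (2 * K).
    rewrite /= unit_clamp_id//; apply: (le_trans (h _)).
      move=> s s01; apply: (le_trans (uP s i)).
      by rewrite ler_peMr// divr_ge0 ?mulr_ge0// exprn_ge0.
    have -> : 2 * A / 2 ^+ i / 2 = A / 2 ^+ i by field; rewrite expf_neq0.
    by rewrite ler_wpM2l ?eA// divr_ge0// exprn_ge0.
  rewrite -(subrKA (v i.+1 t)) (le_trans (ler_normD _ _))//.
  have := uP t i.+1; rewrite distrC exprS invfM.
  have -> : 2 * A * (2^-1 * (2 ^+ i)^-1) = A / 2 ^+ i by field; rewrite expf_neq0.
  by move: h; set q := (2 ^+ i)^-1; lra.
exists (T u); split=> // t t01.
by rewrite uE//; exact: TuD.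
Unshelve. all: by end_near. Qed.

(** * Locally Lipschitz maps *)

Definition locally_lipschitz_at {R : realType} {V W : normedModType R}
    (f : V -> W) (p : V) : Prop :=
  exists K A, [/\ 0 <= K, nbhs p A &
    forall q r, A q -> A r -> `|f q - f r| <= K * `|q - r|].

Lemma locally_lipschitz_continuous {R : realType} {V W : normedModType R}
    (f : V -> W) p : locally_lipschitz_at f p -> {for p, continuous f}.
Proof.
move=> [K [A [K0 pA fK]]]; apply/cvgrPdist_le => e e0.
have K1 : 0 < K + 1 by rewrite ltr_wpDl.
near=> q; have qA : A q by near: q.
apply: (le_trans (fK _ _ (nbhs_singleton pA) qA)).
apply: (@le_trans _ _ ((K + 1) * (e / (K + 1)))); last by rewrite mulrC divfK// gt_eqF.
apply: ler_pM => //; first by rewrite lerDl.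
near: q; apply: cvgr_dist_le; [exact: cvg_id|exact: divr_gt0].
Unshelve. all: by end_near. Qed.

Lemma locally_lipschitz_local {R : realType} {V W : normedModType R}
    (f g : V -> W) p : (\forall q \near p, f q = g q) ->
  locally_lipschitz_at f p -> locally_lipschitz_at g p.
Proof.
move=> fg [K [A [K0 pA fK]]]; exists K, (A `&` [set q | f q = g q]); split=> //.
  exact: filterI.
by move=> q r [Aq /= <-] [Ar /= <-]; exact: fK.
Qed.

Lemma locally_lipschitz_cst {R : realType} {V W : normedModType R} (c : W) (p : V) :
  locally_lipschitz_at (fun=> c) p.
Proof.
exists 0, setT; split=> // [|q r _ _]; first exact: filterT.
by rewrite subrr normr0 mul0r.
Qed.

Lemma lipschitz_locally {R : realType} {V W : normedModType R} (f : V -> W) K p :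
  0 <= K -> (forall q r, `|f q - f r| <= K * `|q - r|) -> locally_lipschitz_at f p.
Proof. by move=> K0 fK; exists K, setT; split=> //; exact: filterT. Qed.

Lemma locally_lipschitzD {R : realType} {V W : normedModType R} (f g : V -> W) p :
  locally_lipschitz_at f p -> locally_lipschitz_at g p ->
  locally_lipschitz_at (fun q => f q + g q) p.
Proof.
move=> [K [A [K0 pA fK]]] [L [B [L0 pB gL]]].
exists (K + L), (A `&` B); split; [exact: addr_ge0|exact: filterI|].
move=> q r [Aq Bq] [Ar Br]; rewrite mulrDl opprD addrACA.
by apply: (le_trans (ler_normD _ _)); apply: lerD; [exact: fK|exact: gL].
Qed.

Lemma locally_lipschitzZ {R : realType} {V W : normedModType R}
    (f : V -> R) (g : V -> W) p :
  locally_lipschitz_at f p -> locally_lipschitz_at g p ->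
  locally_lipschitz_at (fun q => f q *: g q) p.
Proof.
move=> fp gp; have fc := locally_lipschitz_continuous fp.
have gc := locally_lipschitz_continuous gp.
move: fp gp => [K [A [K0 pA fK]]] [L [B [L0 pB gL]]].
pose M := `|f p| + `|g p| + 1.
have M0 : 0 <= M by rewrite !addr_ge0.
exists (K * M + L * M), (A `&` B `&` [set q | `|f q| <= M /\ `|g q| <= M]); split.
- by rewrite addr_ge0// mulr_ge0.
- apply: filterI; first exact: filterI.
  have f1 : \forall q \near p, `|f q| <= M.
    apply: (cvgr_norm_le _ fc); rewrite /M.
    by have := normr_ge0 (f p); have := normr_ge0 (g p); lra.
  have g1 : \forall q \near p, `|g q| <= M.
    apply: (cvgr_norm_le _ gc); rewrite /M.
    by have := normr_ge0 (f p); have := normr_ge0 (g p); lra.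
  by near=> q; split; near: q.
move=> q r [[Aq Bq] [fq gq]] [[Ar Br] [fr gr]].
have -> : f q *: g q - f r *: g r = (f q - f r) *: g q + f r *: (g q - g r).
  by rewrite scalerBl scalerBr subrKA.
rewrite mulrDl (le_trans (ler_normD _ _))// !normrZ lerD//.
- by rewrite mulrAC; apply: ler_pM => //; exact: fK.
- by rewrite mulrAC mulrC; apply: ler_pM => //; exact: gL.
Unshelve. all: by end_near. Qed.

Lemma locally_lipschitzV {R : realType} {V : normedModType R} (f : V -> R) p :
  f p != 0 -> locally_lipschitz_at f p -> locally_lipschitz_at (fun q => (f q)^-1) p.
Proof.
move=> fp0 fp; have fc := locally_lipschitz_continuous fp.
move: fp => [K [A [K0 pA fK]]]; pose m := `|f p| / 2.
have m0 : 0 < m by rewrite divr_gt0// normr_gt0.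
exists (K / (m * m)), (A `&` [set q | m <= `|f q|]); split.
- by rewrite divr_ge0// mulr_ge0// ltW.
- apply: filterI => //; apply: (cvgr_norm_ge _ fc).
  by rewrite /m ltr_pdivrMr// ltr_pMr ?normr_gt0// ltr1n.
move=> q r [Aq /= mq] [Ar /= mr].
have fq0 : f q != 0 by rewrite -normr_gt0 (lt_le_trans m0).
have fr0 : f r != 0 by rewrite -normr_gt0 (lt_le_trans m0).
have -> : (f q)^-1 - (f r)^-1 = (f r - f q) / (f q * f r).
  by field; rewrite fq0 fr0.
rewrite normrM normfV normrM mulrAC distrC; apply: ler_pM => //.
- exact: fK.
- by rewrite lef_pV2 ?posrE ?mulr_gt0 ?normr_gt0//; apply: ler_pM => //; exact: ltW.
Qed.

Lemma locally_lipschitz_sum {R : realType} {V W : normedModType R} (I : Type)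
    (s : seq I) (P : pred I) (f : I -> V -> W) p :
  (forall i, P i -> locally_lipschitz_at (f i) p) ->
  locally_lipschitz_at (fun q => \sum_(i <- s | P i) f i q) p.
Proof.
move=> fp; elim: s => [|i s IH].
  by apply: (@locally_lipschitz_local _ _ _ (fun=> 0));
    [near=> q; rewrite big_nil|exact: locally_lipschitz_cst].
have [Pi|Pi] := boolP (P i).
- apply: (@locally_lipschitz_local _ _ _ (fun q => f i q + \sum_(i <- s | P i) f i q)).
    by near=> q; rewrite big_cons Pi.
  by apply: locally_lipschitzD; [exact: fp|].
- apply: (locally_lipschitz_local _ IH).
  by near=> q; rewrite big_cons (negbTE Pi).
Unshelve. all: by end_near. Qed.

Lemma locally_lipschitz_prod {R : realType} {V : normedModType R} (I : Type)
    (s : seq I) (P : pred I) (f : I -> V -> R) p :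
  (forall i, P i -> locally_lipschitz_at (f i) p) ->
  locally_lipschitz_at (fun q => \prod_(i <- s | P i) f i q) p.
Proof.
move=> fp; elim: s => [|i s IH].
  by apply: (@locally_lipschitz_local R V R (fun=> 1));
    [near=> q; rewrite big_nil|exact: locally_lipschitz_cst].
have [Pi|Pi] := boolP (P i).
- apply: (@locally_lipschitz_local R V R (fun q => f i q *: \prod_(i <- s | P i) f i q)).
    by near=> q; rewrite big_cons Pi.
  by apply: (@locally_lipschitzZ R V R); [exact: fp|].
- apply: (locally_lipschitz_local _ IH).
  by near=> q; rewrite big_cons (negbTE Pi).
Unshelve. all: by end_near. Qed.

Lemma locally_lipschitz_mx {R : realType} {V : normedModType R} {m n}
    (f : V -> 'M[R]_(m, n)) p :
  (forall i j, locally_lipschitz_at (fun q => f q i j) p) ->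
  locally_lipschitz_at f p.
Proof.
move=> fp.
have /choice[K] (ij : 'I_m * 'I_n) : exists K, 0 <= K /\ exists A, nbhs p A /\
    forall q r, A q -> A r -> `|f q ij.1 ij.2 - f r ij.1 ij.2| <= K * `|q - r|.
  by have [K [A [? ? ?]]] := fp ij.1 ij.2; exists K; split=> //; exists A.
move=> /all_and2[K0 /choice[A /all_and2[pA fK]]].
exists (\sum_ij K ij), [set q | forall ij, A ij q]; split.
- exact: sumr_ge0.
- exact: filter_forall.
move=> q r Aq Ar; apply: norm_le_coord; first by rewrite mulr_ge0// sumr_ge0.
move=> i j; rewrite !mxE (le_trans (fK (i, j) _ _ (Aq _) (Ar _)))//.
by rewrite ler_wpM2r// (bigD1 (i, j))//= lerDl sumr_ge0.
Qed.

Lemma locally_lipschitz_coord {R : realType} {V : normedModType R} {m n}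
    (f : V -> 'M[R]_(m, n)) p i j :
  locally_lipschitz_at f p -> locally_lipschitz_at (fun q => f q i j) p.
Proof.
move=> [K [A [K0 pA fK]]]; exists K, A; split=> // q r Aq Ar.
apply: le_trans (fK _ _ Aq Ar).
by have := coord_le_norm (f q - f r) i j; rewrite !mxE.
Qed.

(** Near the diagonal the local constants, of which compactness leaves finitely
    many, do; away from it the bound on [f] does. *)
Lemma compact_lipschitz {R : realType} {V W : normedModType R} (f : V -> W)
    (C : set V) (M : R) :
  compact C -> (forall p, locally_lipschitz_at f p) -> (forall p, `|f p| <= M) ->
  exists K, 0 <= K /\ forall p q, C p -> `|f p - f q| <= K * `|p - q|.
Proof.
move=> Cc fl fM.
have M0 : 0 <= M by exact: le_trans (fM 0).
have : \forall K \near +oo, C `<=` [set p | forall q, `|f p - f q| <= K * `|p - q|].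
  move/compact_near_coveringP : Cc; apply => p Cp.
  have [K [A [K0 /nbhs_ballP[r /= r0 pA] fK]]] := fl p.
  have r20 : 0 < r / 2 by rewrite divr_gt0.
  exists (ball p (r / 2), [set L | K <= L /\ 2 * M / (r / 2) <= L]).
    split; first exact: nbhsx_ballx.
    near=> L; split; near: L; apply: nbhs_pinfty_ge; exact: num_real.
  move=> [p' L] /= [pp' [KL ML]] q.
  have [qr|qr] := ltP `|p' - q| (r / 2).
  - apply: (@le_trans _ _ (K * `|p' - q|)); last by rewrite ler_wpM2r.
    apply: fK; apply: pA.
      by apply: le_ball pp'; lra.
    by rewrite (splitr r); apply: (ball_triangle pp'); rewrite -ball_normE.
  - apply: (@le_trans _ _ (2 * M / (r / 2) * (r / 2))).
      rewrite divfK ?gt_eqF// (le_trans (ler_normB _ _))//.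
      by have := fM p'; have := fM q; lra.
    by apply: ler_pM => //; rewrite ?divr_ge0 ?mulr_ge0// ltW.
move=> [K [Kr KP]]; exists (Num.max 0 K + 1); split.
  by rewrite addr_ge0// le_max lexx.
move=> p q Cp; apply: KP => //.
have : K <= Num.max 0 K by rewrite le_max lexx orbT.
by move=> ?; lra.
Unshelve. all: by end_near. Qed.

(** * Trajectories of fields that vanish on a set *)

(** The fields that occur below: Lipschitz only away from the zeros of [d], but
    so small near them that trajectories keep [d] comparable to its initial
    value. *)
Record tame_field {R : realType} {n} (d : 'rV[R]_n -> R)
    (X : 'rV[R]_n * R -> 'rV[R]_n) (r0 : R) : Prop := TameField {
  tame_ge0 : forall x, 0 <= d x ;
  tame_dist : forall x y, d x <= d y + `|x - y| ;
  tame_le : forall p, `|X p| <= d p.1 / 4 ;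
  tame_lipschitz : forall p, 0 < d p.1 -> locally_lipschitz_at X p ;
  tame_support : forall p, r0 <= `|p.1| -> X p = 0 }.

Definition trajectory {R : realType} {n} (X : 'rV[R]_n * R -> 'rV[R]_n)
    (u : R -> 'rV[R]_n) : Prop :=
  forall t : R, 0 <= t <= 1 -> is_derive t 1 u (X (u t, t)).

Lemma distance_continuous {R : realType} {V : normedModType R} (d : V -> R) :
  (forall x y, d x <= d y + `|x - y|) -> continuous d.
Proof.
move=> dD x; apply: (@locally_lipschitz_continuous R V R).
apply: (@lipschitz_locally R V R _ 1) => // q r; rewrite mul1r ler_norml.
by have := dD q r; have := dD r q; rewrite [`|r - q|]distrC => ? ?;
  apply/andP; split; lra.
Qed.

(** With [D] the maximum of [d] along the trajectory, the speed is at most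
    [D / 4], hence [D - d (u t) <= D / 4] for every [t]. *)
Lemma trajectory_displacement {R : realType} {n} (d : 'rV[R]_n -> R)
    (X : 'rV[R]_n * R -> 'rV[R]_n) (u : R -> 'rV[R]_n) :
  (forall x y, d x <= d y + `|x - y|) -> (forall p, `|X p| <= d p.1 / 4) ->
  trajectory X u ->
  forall s t : R, 0 <= s <= 1 -> 0 <= t <= 1 ->
    `|u s - u t| <= d (u t) / 2 * `|s - t|.
Proof.
move=> dD Xd uX s t s01 t01.
have dc := distance_continuous dD.
have [c|c c01 cmax] := @EVT_max R (fun t => d (u t)) 0 1 ler01.
  apply/continuous_in_subspaceT => r; rewrite inE /= in_itv /= => r01.
  apply: (@continuous_comp _ _ _ u d); last exact: dc.
  exact: is_derive1_continuous (uX _ r01).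
have {}c01 : 0 <= c <= 1 by rewrite in_itv in c01.
have speed a b : 0 <= a <= 1 -> 0 <= b <= 1 -> a <= b ->
    `|u b - u a| <= d (u c) / 4 * (b - a).
  move=> a01 b01 ab.
  rewrite mulrBr; apply: (@mean_value_inequality R n u (fun t => X (u t, t))
    (fun r => d (u c) / 4 * r) (fun=> d (u c) / 4)) => // r /andP[ar rb].
  - by apply: uX; lra.
  - have -> : (fun r => d (u c) / 4 * r) = (d (u c) / 4) *: id by apply/funext.
    by apply: is_derive_eq; rewrite /GRing.scale/= mulr1.
  - apply: (le_trans (Xd _)); rewrite ler_pM2r// ?invr_gt0// cmax// in_itv /=.
    lra.
have {}speed a b : 0 <= a <= 1 -> 0 <= b <= 1 ->
    `|u b - u a| <= d (u c) / 4 * `|b - a|.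
  move=> a01 b01; have [ab|ba] := leP a b.
    by rewrite (ger0_norm (_ : 0 <= b - a)) ?subr_ge0// speed.
  by rewrite distrC [`|b - a|]distrC (ger0_norm (_ : 0 <= a - b)) ?subr_ge0 ?speed// ltW.
have dc0 : 0 <= d (u c) by have := le_trans (normr_ge0 _) (Xd (u c, c)) => /=; lra.
have dct : d (u c) <= 2 * d (u t).
  have := dD (u c) (u t); have := speed t c t01 c01.
  have : d (u c) / 4 * `|c - t| <= d (u c) / 4 * 1.
    by rewrite ler_wpM2l ?divr_ge0// ler_norml; apply/andP; split; lra.
  lra.
apply: (le_trans (speed t s t01 s01)); rewrite ler_wpM2r//; lra.
Qed.

Lemma trajectory_near_start {R : realType} {n} (d : 'rV[R]_n -> R)
    (X : 'rV[R]_n * R -> 'rV[R]_n) (u : R -> 'rV[R]_n) :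
  (forall x y, d x <= d y + `|x - y|) -> (forall p, `|X p| <= d p.1 / 4) ->
  trajectory X u ->
  forall s t : R, 0 <= s <= 1 -> 0 <= t <= 1 -> `|u s - u t| <= d (u t) / 2.
Proof.
move=> dD Xd uX s t s01 t01.
apply: (le_trans (trajectory_displacement dD Xd uX s01 t01)).
have : 0 <= d (u t) by have := le_trans (normr_ge0 _) (Xd (u t, t)) => /=; lra.
move=> dt; rewrite ler_piMr ?divr_ge0// ler_norml; apply/andP; split; lra.
Qed.

(** The field cut off near the zeros of [d], where it fails to be Lipschitz. *)
Definition truncated_field {R : realType} {n} (d : 'rV[R]_n -> R)
    (X : 'rV[R]_n * R -> 'rV[R]_n) (delta : R) (p : 'rV[R]_n * R) : 'rV[R]_n :=
  unit_clamp (d p.1 / delta - 1) *: X p.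

Lemma truncated_field_id {R : realType} {n} (d : 'rV[R]_n -> R)
    (X : 'rV[R]_n * R -> 'rV[R]_n) (delta : R) p :
  0 < delta -> 2 * delta <= d p.1 -> truncated_field d X delta p = X p.
Proof.
move=> delta0 dp; rewrite /truncated_field /unit_clamp min_l.
  by rewrite max_r ?scale1r.
by rewrite lerBrDr ler_pdivlMr.
Qed.

Lemma truncated_field_le {R : realType} {n} (d : 'rV[R]_n -> R) X (r0 delta : R) :
  tame_field d X r0 -> forall p, `|truncated_field d X delta p| <= d p.1 / 4.
Proof.
move=> tX p; rewrite normrZ.
have /andP[c0 c1] := unit_clamp_itv (d p.1 / delta - 1).
rewrite ger0_norm// (le_trans _ (tame_le tX p))//.
by rewrite ler_piMl.
Qed.

Lemma truncated_field_locally_lipschitz {R : realType} {n} (d : 'rV[R]_n -> R) X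
    (r0 delta : R) : tame_field d X r0 -> 0 < delta ->
  forall p, locally_lipschitz_at (truncated_field d X delta) p.
Proof.
move=> tX delta0 p.
have d1c : continuous (fun p : 'rV[R]_n * R => d p.1).
  move=> q; apply: (@continuous_comp _ _ _ fst d); first exact: cvg_fst.
  exact: distance_continuous (tame_dist tX) _.
have [dp|dp] := ltP 0 (d p.1); last first.
  apply: (locally_lipschitz_local _ (locally_lipschitz_cst 0 p)).
  have : \forall q \near p, d q.1 < delta.
    by apply: (cvgr_lt _ (d1c p)); rewrite (le_lt_trans dp).
  apply: filterS => q dq; rewrite /truncated_field /unit_clamp.
  have q0 : d q.1 / delta - 1 <= 0 by rewrite subr_le0 ler_pdivrMr// mul1r ltW.
  by rewrite min_r ?max_l ?scale0r// (le_trans q0).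
apply: (@locally_lipschitzZ R _ _ (fun q => unit_clamp (d q.1 / delta - 1)));
  last exact: (tame_lipschitz tX).
have di0 : 0 <= delta^-1 by rewrite invr_ge0 ltW.
apply: (@lipschitz_locally R _ R _ (delta^-1)) => //.
move=> q r; apply: (le_trans (unit_clamp_lipschitz _ _)).
rewrite opprB addrA subrK -mulrBl normrM [`|delta^-1|]ger0_norm//.
rewrite [leRHS]mulrC ler_pM2r ?invr_gt0//.
apply: (@le_trans _ _ `|q.1 - r.1|); last by rewrite /Num.Def.normr /= le_max lexx.
have := tame_dist tX q.1 r.1; have := tame_dist tX r.1 q.1.
by rewrite [`|r.1 - q.1|]distrC => ? ?; rewrite ler_norml; apply/andP; split; lra.
Qed.

Lemma closed_ball_compact {R : realType} {n} (r : R) :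
  compact [set x : 'rV[R]_n | `|x| <= r].
Proof.
apply: bounded_closed_compact.
- exists r; split; first exact: num_real.
  by move=> M rM x /= xr; rewrite (le_trans xr)// ltW.
- apply: (@preimage_closed _ _ (Num.norm : 'rV[R]_n -> R) [set y | y <= r]);
    last exact: closed_le.
  by move=> x _; exact: norm_continuous.
Qed.

Lemma truncated_field_lipschitz {R : realType} {n} (d : 'rV[R]_n -> R) X
    (r0 delta : R) : tame_field d X r0 -> 0 < delta ->
  exists K, 0 <= K /\ forall (t : R) x y, 0 <= t <= 1 ->
    `|truncated_field d X delta (x, t) - truncated_field d X delta (y, t)| <=
    K * `|x - y|.
Proof.
move=> tX delta0; set Y := truncated_field d X delta.
have Y0 p : r0 <= `|p.1| -> Y p = 0.
  by move=> /(tame_support tX); rewrite /Y /truncated_field => ->; rewrite scaler0.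
have YM p : `|Y p| <= (d 0 + `|r0|) / 4.
  have d0 := tame_ge0 tX 0.
  have [pr|pr] := leP r0 `|p.1|.
    by rewrite Y0// normr0 divr_ge0// addr_ge0.
  apply: (le_trans (truncated_field_le _ tX _)); rewrite ler_pM2r ?invr_gt0//.
  apply: (le_trans (tame_dist tX _ 0)); rewrite subr0 lerD2l.
  by rewrite (le_trans (ltW pr))// ler_norm.
have Kc : compact ([set x : 'rV[R]_n | `|x| <= r0] `*` (`[0, 1]%classic : set R)).
  by apply: compact_setX; [exact: closed_ball_compact|exact: segment_compact].
have [K [K0 YK]] := compact_lipschitz Kc
  (truncated_field_locally_lipschitz tX delta0) YM.
have sq (x y : 'rV[R]_n) (t : R) : `|(x, t) - (y, t)| = `|x - y|.
  rewrite (_ : `|(x, t) - (y, t)| = Num.max `|x - y| `|t - t|)//.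
  by rewrite subrr normr0 max_l.
exists K; split=> // t x y t01.
have [xr|xr] := leP `|x| r0.
  by have := YK (x, t) (y, t); rewrite sq; apply; split; rewrite //= in_itv.
have [yr|yr] := leP `|y| r0.
  rewrite distrC [`|x - y|]distrC.
  by have := YK (y, t) (x, t); rewrite sq; apply; split; rewrite //= in_itv.
by rewrite !Y0 /= ?(ltW xr) ?(ltW yr)// subrr normr0 mulr_ge0.
Qed.

Lemma tame_trajectory_exists {R : realType} {n} (d : 'rV[R]_n -> R) X (r0 s : R) x :
  tame_field d X r0 -> 0 <= s <= 1 -> exists u, u s = x /\ trajectory X u.
Proof.
move=> tX s01.
have [dx|dx] := ltP 0 (d x); last first.
  exists (cst x); split=> // t t01.
  have -> : X (cst x t, t) = 0.
    apply/eqP; rewrite -normr_le0 (le_trans (tame_le tX _))//=; lra.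
  exact: is_derive_cst.
(* A trajectory of the truncated field from [x] keeps [d] above [2 / 3 * d x],
   hence above [2 * delta], where the truncation has no effect. *)
pose delta := d x / 4.
have delta0 : 0 < delta by rewrite divr_gt0.
have [K [K0 YK]] := truncated_field_lipschitz tX delta0.
have [|u [us uD]] := @picard R n (truncated_field d X delta) K s x _ K0 s01 YK.
  move=> p; apply: locally_lipschitz_continuous.
  exact: truncated_field_locally_lipschitz tX delta0 p.
exists u; split=> // t t01.
have := uD t t01; rewrite truncated_field_id//=.
have := trajectory_near_start (tame_dist tX) (truncated_field_le delta tX) uD t01 s01.
have := tame_dist tX (u s) (u t); rewrite distrC us /delta; lra.
Qed.

Lemma trajectory_lipschitz_dependence {R : realType} {n} (d : 'rV[R]_n -> R) X
    (r0 delta : R) : tame_field d X r0 -> 0 < delta ->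
  exists K, 0 <= K /\ forall u v, trajectory X u -> trajectory X v ->
    (forall t : R, 0 <= t <= 1 -> 2 * delta <= d (u t)) ->
    (forall t : R, 0 <= t <= 1 -> 2 * delta <= d (v t)) ->
    forall s t : R, 0 <= s <= 1 -> 0 <= t <= 1 ->
      `|u t - v t| <= K * `|u s - v s|.
Proof.
move=> tX delta0; have [K [K0 YK]] := truncated_field_lipschitz tX delta0.
exists (2 * expR (2 * K)); split; first by rewrite mulr_ge0// expR_ge0.
move=> u v uX vX ud vd s t s01 t01.
have := @gronwall R n (u - v) (fun t => X (u t, t) - X (v t, t)) s K s01 K0.
move=> h; have {}h := h _ _ t t01.
rewrite -[(u - v) t]/(u t - v t) -[(u - v) s]/(u s - v s) in h.
apply: (le_trans (h _ _)).
- by move=> r r01; have ? := uX r r01; have ? := vX r r01; apply: is_deriveB.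
- move=> r r01; have := YK r (u r) (v r) r01.
  by rewrite !truncated_field_id//; [exact: vd|exact: ud].
rewrite mulrAC ler_wpM2r// ler_wpM2l// ler_expR ler_piMr ?mulr_ge0//.
by rewrite ler_norml; apply/andP; split; lra.
Qed.

Lemma tame_trajectory_lower {R : realType} {n} (d : 'rV[R]_n -> R) X (r0 s t : R) u :
  tame_field d X r0 -> trajectory X u -> 0 <= s <= 1 -> 0 <= t <= 1 ->
  2 / 3 * d (u s) <= d (u t).
Proof.
move=> tX uX s01 t01.
have := trajectory_near_start (tame_dist tX) (tame_le tX) uX s01 t01.
have := tame_dist tX (u s) (u t); lra.
Qed.

Lemma tame_trajectory_unique {R : realType} {n} (d : 'rV[R]_n -> R) X (r0 s t : R) u v :
  tame_field d X r0 -> trajectory X u -> trajectory X v -> u s = v s ->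
  0 <= s <= 1 -> 0 <= t <= 1 -> u t = v t.
Proof.
move=> tX uX vX uv s01 t01; apply/eqP; rewrite -subr_eq0 -normr_le0.
have [ds|ds] := ltP 0 (d (u s)).
  have ds3 : 0 < d (u s) / 3 by rewrite divr_gt0.
  have [K [K0 uK]] := trajectory_lipschitz_dependence tX ds3.
  apply: (le_trans (uK u v uX vX _ _ s t s01 t01)).
  - by move=> r r01; have := tame_trajectory_lower tX uX s01 r01; lra.
  - by move=> r r01; have := tame_trajectory_lower tX vX s01 r01; rewrite -uv; lra.
  by rewrite uv subrr normr0 mulr0.
have := trajectory_near_start (tame_dist tX) (tame_le tX) uX t01 s01.
have := trajectory_near_start (tame_dist tX) (tame_le tX) vX t01 s01.
rewrite -uv [`|v t - _|]distrC => h1 h2.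
by rewrite -(subrKA (u s)) (le_trans (ler_normD _ _))//; lra.
Qed.

(** * The flow *)

(** Where [d] vanishes no Lipschitz constant is available, but there the
    trajectories starting near [x0] move by at most half of [d x], and
    [d x <= `|x - x0|]. *)
Lemma trajectory_uniform_dependence {R : realType} {n} (d : 'rV[R]_n -> R) X
    (r0 s : R) (Phi : 'rV[R]_n -> R -> 'rV[R]_n) (x0 : 'rV[R]_n) (e : R) :
  tame_field d X r0 -> 0 <= s <= 1 -> 0 < e ->
  (forall x, Phi x s = x /\ trajectory X (Phi x)) ->
  \forall x \near x0, forall t : R, 0 <= t <= 1 -> `|Phi x t - Phi x0 t| <= e.
Proof.
move=> tX s01 e0 PhiP; have [dx0|dx0] := ltP 0 (d x0).
- (* For [x] this close to [x0] one has [d x >= 3 / 4 * d x0], so that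
     trajectories keep [d] above [d x0 / 2]. *)
  have delta0 : 0 < d x0 / 4 by rewrite divr_gt0.
  have [K [K0 PhiK]] := trajectory_lipschitz_dependence tX delta0.
  have K1 : 0 < K + 1 by rewrite ltr_wpDl.
  near=> x => t t01.
  have xx0 : `|x0 - x| <= d x0 / 4 by near: x; exact: cvgr_dist_le.
  have [Ps PX] := PhiP x; have [Ps0 PX0] := PhiP x0.
  apply: (le_trans (PhiK _ _ PX PX0 _ _ s t s01 t01)).
  - move=> r r01; have := tame_trajectory_lower tX PX s01 r01; rewrite Ps.
    have := tame_dist tX x0 x; lra.
  - by move=> r r01; have := tame_trajectory_lower tX PX0 s01 r01; rewrite Ps0; lra.
  rewrite Ps Ps0 distrC; apply: (@le_trans _ _ ((K + 1) * (e / (K + 1)))).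
    apply: ler_pM => //; first by rewrite lerDl.
    by near: x; apply: cvgr_dist_le => //; rewrite divr_gt0.
  by rewrite mulrC divfK// gt_eqF.
- near=> x => t t01.
  have [Ps PX] := PhiP x; have [Ps0 PX0] := PhiP x0.
  have := trajectory_near_start (tame_dist tX) (tame_le tX) PX t01 s01.
  have := trajectory_near_start (tame_dist tX) (tame_le tX) PX0 t01 s01.
  rewrite Ps Ps0 => h0 h1.
  have xx0 : `|x0 - x| <= e / 2 by near: x; apply: cvgr_dist_le => //; rewrite divr_gt0.
  have := tame_dist tX x x0; rewrite distrC => dx.
  have -> : Phi x t - Phi x0 t = (Phi x t - x) - ((x0 - x) + (Phi x0 t - x0)).
    by rewrite [x0 - x + _]addrC subrKA opprB addrC addrA subrK addrC.
  rewrite (le_trans (ler_normB _ _))//.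
  have := ler_normD (x0 - x) (Phi x0 t - x0); lra.
Unshelve. all: by end_near. Qed.

(** [Phi s x t] is the position at time [t] of the trajectory that is at [x] at
    time [s]; by uniqueness, [Phi t ^~ s] inverts [Phi s ^~ t]. *)
Lemma tame_flow {R : realType} {n} (d : 'rV[R]_n -> R) X (r0 : R) :
  tame_field d X r0 -> exists Phi : R -> 'rV[R]_n -> R -> 'rV[R]_n,
    forall s : R, 0 <= s <= 1 ->
    [/\ forall x, Phi s x s = x /\ trajectory X (Phi s x),
        forall x (t : R), 0 <= t <= 1 -> Phi t (Phi s x t) s = x,
        forall x (t : R), 0 <= t <= 1 -> `|Phi s x t - x| <= d x / 2,
        forall t : R, 0 <= t <= 1 -> continuous (fun x => Phi s x t) &
        {within setT `*` `[0, 1]%classic, continuous (fun p => Phi s p.1 p.2)}].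
Proof.
move=> tX.
have /choice[F FP] (sx : R * 'rV[R]_n) : exists u, 0 <= sx.1 <= 1 ->
    u sx.1 = sx.2 /\ trajectory X u.
  have [s01|/negP] := boolP (0 <= sx.1 <= 1); last by exists (cst 0).
  by have [u ?] := tame_trajectory_exists sx.2 tX s01; exists u.
pose Phi s x := F (s, x).
have PhiP s : 0 <= s <= 1 -> forall x, Phi s x s = x /\ trajectory X (Phi s x).
  by move=> s01 x; exact: (FP (s, x)).
exists Phi => s s01; split=> [|x t t01|x t t01|t t01|].
- exact: PhiP.
- have [h1 h2] := PhiP _ s01 x; have [h3 h4] := PhiP _ t01 (Phi s x t).
  by rewrite (tame_trajectory_unique tX h4 h2 h3 t01 s01) h1.
- have [h1 h2] := PhiP _ s01 x.
  have := trajectory_near_start (tame_dist tX) (tame_le tX) h2 t01 s01.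
  by rewrite h1.
- move=> x0; apply/(@cvgrPdist_le _ _ _ (nbhs x0)) => e e0.
  apply: (@filterS _ (nbhs x0) _ _ _ _ (trajectory_uniform_dependence x0 tX s01 e0 (PhiP s s01))) => x /(_ t t01).
  by rewrite distrC.
- apply/subspace_continuousP => -[x0 t0] [_ /=]; rewrite in_itv /= => t001.
  apply/cvgrPdist_le => e e0.
  have e20 : 0 < e / 2 by rewrite divr_gt0.
  have [h1 h2] := PhiP _ s01 x0.
  have xP := trajectory_uniform_dependence x0 tX s01 e20 (PhiP s s01).
  have /cvgrPdist_le/(_ _ e20) tP := is_derive1_continuous (h2 t0 t001).
  rewrite near_withinE.
  have : nbhs (x0, t0) ([set x | forall t : R, 0 <= t <= 1 ->
      `|Phi s x t - Phi s x0 t| <= e / 2] `*`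
      [set t | `|Phi s x0 t0 - Phi s x0 t| <= e / 2]).
    by exists ([set x | forall t : R, 0 <= t <= 1 ->
      `|Phi s x t - Phi s x0 t| <= e / 2],
      [set t | `|Phi s x0 t0 - Phi s x0 t| <= e / 2]).
  apply: filterS => -[x t] [/= xle tle] [_ /=]; rewrite in_itv /= => t01.
  have := xle t t01; rewrite distrC => {}xle.
  rewrite -(subrKA (Phi s x0 t)) (le_trans (ler_normD _ _))//; lra.
Unshelve. all: by end_near. Qed.

(** * Maps of class C^k *)

Lemma near_eq_differentiable {R : realType} {V W : normedModType R}
    (f g : V -> W) x : (\forall y \near x, f y = g y) -> differentiable f x ->
  differentiable g x /\ 'd g x = 'd f x :> (V -> W).
Proof.
move=> fg fD.
have gE : g \o shift x = cst (g x) + 'd f x +o_ (0 : V) id.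
  apply/eqaddoP => e e0.
  have /eqaddoP fE0 := diff_locally fD; have fE := fE0 e e0.
  have fg0 : \forall h \near (0 : V), f (h + x) = g (h + x).
    have shc : (fun h : V => h + x) @ (0 : V) --> x.
      rewrite -[X in _ --> X]add0r; apply: cvgD; [exact: cvg_id|exact: cvg_cst].
    exact: shc fg.
  near=> h.
  rewrite -(nbhs_singleton fg).
  have -> : (g \o shift x - (cst (f x) + 'd f x)) h =
            (f \o shift x - (cst (f x) + 'd f x)) h.
    rewrite -[LHS]/(g (h + x) - (f x + 'd f x h)).
    by rewrite -[RHS]/(f (h + x) - (f x + 'd f x h)) (near fg0 h).
  by near: h.
have dgE : 'd g x = 'd f x :> (V -> W).
  by apply: diff_unique => //; exact: diff_continuous.
by split=> //; apply/diff_locallyP; rewrite dgE; split=> //; exact: diff_continuous.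
Unshelve. all: by end_near. Qed.

Lemma curve_chain_rule {R : realType} {V W : normedModType R} (g : V -> W)
    (u : R -> V) (du : V) (t : R) :
  differentiable g (u t) -> is_derive t 1 u du ->
  is_derive t 1 (fun s => g (u s)) ('d g (u t) du).
Proof.
move=> gD [uD <-]; have uD' := (derivable1_diffP _ _).1 uD.
have guD := differentiable_comp uD' gD.
apply: DeriveDef; first exact/derivable1_diffP.
rewrite (deriveE _ guD) -[_ \o u]/(g \o u) diff_comp//=.
by rewrite -(deriveE _ uD').
Qed.

Lemma is_derive_line {R : realType} {V : normedModType R} (x v : V) (s : R) :
  is_derive s 1 (fun s : R => x + s *: v) v.
Proof.
have -> : (fun s : R => x + s *: v) = cst x + *:%R^~ v by apply/funext.
rewrite -[X in is_derive _ _ _ X]add0r; apply: is_deriveD.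
have lD := is_diff_scalel s v.
apply: DeriveDef; first exact/derivable1_diffP.
by rewrite deriveE// diff_val scale1r.
Qed.

Lemma class_C_continuous {R : realType} {n m k} (U : set 'rV[R]_n)
    (f : 'rV[R]_n -> 'rV[R]_m) x : class_C k U f -> U x -> {for x, continuous f}.
Proof.
by case: k => [|k] /=; [move=> h; exact: h|move=> [h _] /h/differentiable_continuous].
Qed.

Lemma class_C_subset {R : realType} {n m k} (U V : set 'rV[R]_n)
    (f : 'rV[R]_n -> 'rV[R]_m) : V `<=` U -> class_C k U f -> class_C k V f.
Proof.
move=> VU; elim: k f => [|k IH] f /=; first by move=> fc x /VU/fc.
by move=> [fD fC]; split=> [x /VU/fD//|v]; exact: IH.
Qed.

Lemma class_C_congr {R : realType} {n m k} (U : set 'rV[R]_n)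
    (f g : 'rV[R]_n -> 'rV[R]_m) : open U -> (forall x, U x -> f x = g x) ->
  class_C k U f -> class_C k U g.
Proof.
move=> Uo; elim: k f g => [|k IH] f g fg /=.
  move=> fc x Ux; have xU : nbhs x U by exact: open_nbhs_nbhs.
  have fgx : {near x, f =1 g} by apply: filterS xU.
  rewrite /prop_for /continuous_at -(fg _ Ux).
  exact: cvg_trans (near_eq_cvg fgx) (fc x Ux).
move=> [fD fC]; have dfg x : U x -> differentiable g x /\ 'd g x = 'd f x :> (_ -> _).
  move=> Ux; apply: near_eq_differentiable (fD x Ux).
  by apply: filterS (open_nbhs_nbhs (conj Uo Ux)).
split=> [x /dfg[]//|v]; apply: IH (fC v) => x Ux.
have [_ dE] := dfg x Ux.
exact: (esym (congr1 (fun h : 'rV[R]_n -> 'rV[R]_m => h v) dE)).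
Qed.

Lemma diff_lin_apply {R : realType} {V W : normedModType R} (c : R)
    (f g : V -> W) x v : differentiable f x -> differentiable g x ->
  'd (c *: f + g) x v = c *: 'd f x v + 'd g x v.
Proof.
move=> fD gD; have cfD := differentiableZ c fD.
apply: (etrans (congr1 (fun h : V -> W => h v) (diffD cfD gD))) => /=.
exact: (congr1 (fun h : V -> W => h v + 'd g x v) (diffZ c fD)).
Qed.

Lemma class_C_lin {R : realType} {n m k} (U : set 'rV[R]_n) (c : R)
    (f g : 'rV[R]_n -> 'rV[R]_m) : open U -> class_C k U f -> class_C k U g ->
  class_C k U (c *: f + g).
Proof.
move=> Uo; elim: k f g => [|k IH] f g /=.
  move=> fc gc x Ux; apply: continuousD; last exact: gc.
  exact: (@cvgZ _ _ _ (nbhs x) _ (fun=> c) f c (f x) (cvg_cst c) (fc x Ux)).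
move=> [fD fC] [gD gC]; split=> [x Ux|v].
  by apply: differentiableD; [exact/differentiableZ/fD|exact: gD].
apply: class_C_congr (IH _ _ (fC v) (gC v)) => // x Ux.
exact: (esym (diff_lin_apply c v (fD x Ux) (gD x Ux))).
Qed.

(** * Iterated directional derivatives and Taylor's formula *)

(** Up to a factor, the terms of [jet]. *)
Definition dir_iter {R : realType} {n m} (j : nat) (v : 'rV[R]_n)
    (f : 'rV[R]_n -> 'rV[R]_m) : 'rV[R]_n -> 'rV[R]_m :=
  iter j (fun G x => 'D_v G x) f.

Lemma dir_iterSr {R : realType} {n m} j (v : 'rV[R]_n) (f : 'rV[R]_n -> 'rV[R]_m) :
  dir_iter j.+1 v f = dir_iter j v (fun x => 'D_v f x).
Proof. by rewrite /dir_iter iterSr. Qed.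

Lemma dir_iter_congr {R : realType} {n m} j (v : 'rV[R]_n) (U : set 'rV[R]_n)
    (f g : 'rV[R]_n -> 'rV[R]_m) : open U -> (forall x, U x -> f x = g x) ->
  forall x, U x -> dir_iter j v f x = dir_iter j v g x.
Proof.
move=> Uo fg; elim: j => [|j IH] x Ux /=; first exact: fg.
apply: near_eq_derive; apply: filterS (open_nbhs_nbhs (conj Uo Ux)) => y.
exact: IH.
Qed.

Lemma class_C_derive {R : realType} {n m k} (U : set 'rV[R]_n)
    (f : 'rV[R]_n -> 'rV[R]_m) v : open U -> class_C k.+1 U f ->
  class_C k U (fun x => 'D_v f x).
Proof.
move=> Uo [fD fC]; apply: class_C_congr (fC v) => // x Ux.
by rewrite (deriveE _ (fD x Ux)).
Qed.

Lemma class_C_dir_iter {R : realType} {n m} j i v (U : set 'rV[R]_n)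
    (f : 'rV[R]_n -> 'rV[R]_m) : open U -> class_C (j + i) U f ->
  class_C i U (dir_iter j v f).
Proof.
move=> Uo; elim: j f => [//|j IH] f fC.
by rewrite dir_iterSr; apply: IH; exact: class_C_derive.
Qed.

Lemma dir_iter_lin {R : realType} {n m} j k v c (U : set 'rV[R]_n)
    (f g : 'rV[R]_n -> 'rV[R]_m) : open U -> (j <= k)%N ->
  class_C k U f -> class_C k U g -> forall x, U x ->
  dir_iter j v (c *: f + g) x = c *: dir_iter j v f x + dir_iter j v g x.
Proof.
move=> Uo; elim: j k f g => [//|j IH] [//|k] f g jk fC gC x Ux.
have jk' : (j <= k)%N by [].
rewrite !dir_iterSr -(IH k _ _ jk' (class_C_derive v Uo fC) (class_C_derive v Uo gC) x Ux).
apply: (dir_iter_congr _ _ Uo) => // y Uy.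
have fy : derivable f y v by exact/diff_derivable/(fC.1 y Uy).
have gy : derivable g y v by exact/diff_derivable/(gC.1 y Uy).
have cfy : derivable (c *: f) y v by exact: derivableZ.
have E1 : 'D_v (c *: f + g) y = 'D_v (c *: f) y + 'D_v g y by exact: deriveD.
have E2 : 'D_v (c *: f) y = c *: 'D_v f y by exact: deriveZ.
by rewrite E1 E2.
Qed.

Lemma dir_iter_sum {R : realType} {n m} (I : Type) (s : seq I) (c : I -> R) j k v
    (U : set 'rV[R]_n) (f : I -> 'rV[R]_n -> 'rV[R]_m) : open U -> (j <= k)%N ->
  (forall i, class_C k U (f i)) ->
  class_C k U (\sum_(i <- s) c i *: f i) /\ forall x, U x ->
  dir_iter j v (\sum_(i <- s) c i *: f i) x = \sum_(i <- s) c i *: dir_iter j v (f i) x.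
Proof.
move=> Uo jk fC; elim: s => [|i s [IHC IH]].
  have C0 l : class_C l U (0 : 'rV[R]_n -> 'rV[R]_m).
    elim: l => [|l IH] /=.
      by move=> x _; exact: (@cst_continuous 'rV[R]_n 'rV[R]_m 0).
    split=> [x _|u]; first exact: differentiable_cst.
    apply: class_C_congr IH => // x _.
    exact: (esym (congr1 (fun h : 'rV[R]_n -> 'rV[R]_m => h u) (diff_cst 0 x))).
  rewrite big_nil; split=> // x Ux; rewrite big_nil.
  have := dir_iter_lin v (-1) Uo jk (C0 k) (C0 k) Ux.
  by rewrite scaler0 addr0 scaleN1r addNr.
rewrite big_cons; split; first exact: class_C_lin.
by move=> x Ux; rewrite (dir_iter_lin _ _ Uo jk)// big_cons IH.
Qed.

Lemma linear_coord_sum {R : realType} {n} {W : lmodType R}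
    (L : {linear 'rV[R]_n -> W}) (v : 'rV[R]_n) :
  L v = \sum_i v ord0 i *: L (delta_mx ord0 i).
Proof.
rewrite {1}(row_sum_delta v) linear_sum; apply: eq_bigr => i _.
by rewrite linearZ.
Qed.

(** The [k]-th derivative is a form of degree [k] in the direction with
    continuous coefficients; this is what makes the estimate uniform in [v]. *)
Lemma dir_iter_near {R : realType} {n m} k (U : set 'rV[R]_n)
    (f : 'rV[R]_n -> 'rV[R]_m) a e : open U -> U a -> class_C k U f -> 0 < e ->
  \forall y \near a, forall v, `|dir_iter k v f y - dir_iter k v f a| <= e * `|v| ^+ k.
Proof.
move=> Uo Ua; elim: k f e => [|k IH] f e fC e0.
  have /cvgrPdist_le/(_ e e0) := fC a Ua; apply: filterS => y fy v.
  by rewrite expr0 mulr1 distrC.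
have n0 : 0 < n.+1%:R :> R by rewrite ltr0n.
have en0 : 0 < e / n.+1%:R by exact: divr_gt0.
have : \forall y \near a, forall i : 'I_n, forall v,
    `|dir_iter k v (fun x => 'd f x (delta_mx ord0 i)) y -
      dir_iter k v (fun x => 'd f x (delta_mx ord0 i)) a| <= e / n.+1%:R * `|v| ^+ k.
  by apply: (@filter_forall _ _ _ (nbhs a) _) => i; apply: IH => //; exact: fC.2.
have := open_nbhs_nbhs (conj Uo Ua); apply: filterS2 => y Uy yP v.
have vE x : U x -> dir_iter k.+1 v f x = \sum_i v ord0 i *:
    dir_iter k v (fun x => 'd f x (delta_mx ord0 i)) x.
  move=> Ux; rewrite dir_iterSr.
  have [_ <-//] := dir_iter_sum (index_enum 'I_n) (fun i => v ord0 i) v Uo (leqnn k)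
    (fun i => fC.2 (delta_mx ord0 i)).
  apply: (dir_iter_congr _ _ Uo) Ux => z Uz.
  apply: (etrans (deriveE v (fC.1 z Uz))).
  apply: (etrans (linear_coord_sum ('d f z) v)).
  by rewrite fct_sumE.
rewrite !vE// -sumrB (le_trans (ler_norm_sum _ _ _))//.
apply: (@le_trans _ _ (\sum_(i < n) (e / n.+1%:R * `|v| ^+ k.+1))).
  apply: ler_sum => i _; rewrite -scalerBr normrZ exprS.
  rewrite [leRHS]mulrCA; apply: ler_pM => //; exact: coord_le_norm.
rewrite sumr_const card_ord -[leLHS]mulr_natr.
have -> : e / n.+1%:R * `|v| ^+ k.+1 * n%:R = n%:R / n.+1%:R * (e * `|v| ^+ k.+1).
  by ring.
rewrite ler_piMl ?mulr_ge0 ?exprn_ge0 ?(ltW e0)//.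
by rewrite ler_pdivrMr// mul1r ler_nat.
Qed.

Lemma is_derive_scalel {R : realType} {m n} (p : R -> R) (dp : R)
    (c : 'M[R]_(m, n)) (r : R) :
  is_derive r 1 p dp -> is_derive r 1 (fun s => p s *: c) (dp *: c).
Proof.
move=> pD; apply: is_derive_mx => i j.
have -> : (fun s => (p s *: c) i j) = (c i j) *: p.
  by apply/funext => s; rewrite mxE mulrC.
by apply: is_derive_eq; rewrite mxE mulrC.
Qed.

Lemma taylor_curve {R : realType} {n} k (phi : nat -> R -> 'rV[R]_n) (M : R) :
  (forall j (s : R), (j < k)%N -> 0 <= s <= 1 ->
     is_derive s 1 (phi j) (phi j.+1 s)) ->
  (forall s : R, 0 <= s <= 1 -> `|phi k s - phi k 0| <= M) ->
  forall s : R, 0 <= s <= 1 ->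
    `|phi 0%N s - \sum_(j < k.+1) (s ^+ j / j`!%:R) *: phi j 0| <= M.
Proof.
elim: k phi => [|k IH] phi phiD phiM s s01.
  by rewrite big_ord1 expr0 fact0 divr1 scale1r phiM.
have M0 : 0 <= M by apply: le_trans (phiM 0 _); rewrite ?lexx ?ler01.
have IHs := IH (fun j => phi j.+1) (fun j s jk => phiD j.+1 s jk) phiM.
pose T (s : R) : 'rV[R]_n := \sum_(j < k.+2) (s ^+ j / j`!%:R) *: phi j 0.
pose dT (s : R) : 'rV[R]_n := \sum_(j < k.+1) (s ^+ j / j`!%:R) *: phi j.+1 0.
have TD (r : R) : is_derive r 1 T (dT r).
  have -> : T = cst (phi 0%N 0) +
      \sum_(j < k.+1) (fun s => (s ^+ j.+1 / j.+1`!%:R) *: phi j.+1 0).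
    apply/funext => x; rewrite /T big_ord_recl expr0 fact0 divr1 scale1r.
    by rewrite -[RHS]/(_ + _) fct_sumE.
  rewrite -[dT r]add0r; apply: is_deriveD; apply: is_derive_sum => j.
  apply: is_derive_scalel.
  have -> : (fun s : R => s ^+ j.+1 / j.+1`!%:R) = (j.+1`!%:R^-1) *: (id ^+ j.+1).
    by apply/funext => x; rewrite mulrC exprfctE.
  apply: is_derive_eq; rewrite /GRing.scale /= mulr1 factS natrM.
  by rewrite invfM mulrACA mulVf ?pnatr_eq0// mul1r mulrC.
have T0 : T 0 = phi 0%N 0.
  rewrite /T big_ord_recl expr0 fact0 divr1 scale1r big1 ?addr0// => i _.
  by rewrite exprS !mul0r scale0r.
have /andP[s0 s1] := s01.
have := @mean_value_inequality R n (fun r => phi 0%N r - T r)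
  (fun r => phi 1%N r - dT r) (fun r => M * r) (fun=> M) 0 s s0.
rewrite /= T0 subrr subr0 mulr0 subr0 => h; apply: (le_trans (h _ _ _)).
- move=> r /andP[r0 rs]; have r01 : 0 <= r <= 1 by rewrite r0 (le_trans rs).
  by have ? := phiD 0%N r isT r01; have ? := TD r; apply: is_deriveB.
- move=> r _; have -> : (fun r => M * r) = M *: id by apply/funext.
  by apply: is_derive_eq; rewrite /GRing.scale/= mulr1.
- move=> r /andP[r0 rs]; apply: IHs.
  by rewrite r0 (le_trans rs).
- by rewrite ler_piMr.
Qed.

Lemma taylor_segment {R : realType} {n m} k (U : set 'rV[R]_n)
    (f : 'rV[R]_n -> 'rV[R]_m) x v M : open U -> class_C k U f ->
  (forall s : R, 0 <= s <= 1 -> U (x + s *: v)) ->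
  (forall s : R, 0 <= s <= 1 ->
     `|dir_iter k v f (x + s *: v) - dir_iter k v f x| <= M) ->
  forall s : R, 0 <= s <= 1 ->
    `|f (x + s *: v) - \sum_(j < k.+1) s ^+ j *: (j`!%:R^-1 *: dir_iter j v f x)| <= M.
Proof.
move=> Uo fC xU fM s s01.
have := @taylor_curve R m k (fun j s => dir_iter j v f (x + s *: v)) M _ _ s s01.
rewrite scale0r addr0 => h.
have -> : \sum_(j < k.+1) s ^+ j *: (j`!%:R^-1 *: dir_iter j v f x) =
    \sum_(j < k.+1) (s ^+ j / j`!%:R) *: dir_iter j v f x.
  by apply: eq_bigr => j _; rewrite scalerA.
apply: h => // j r jk r01.
have [jD _] : class_C (k - j).-1.+1 U (dir_iter j v f).
  by rewrite prednK ?subn_gt0//; apply: class_C_dir_iter => //; rewrite subnKC// ltnW.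
have jx := jD _ (xU r r01).
have := @curve_chain_rule R _ _ (dir_iter j v f) (fun s : R => x + s *: v) v r jx
  (is_derive_line x v r).
by rewrite -(deriveE v jx).
Qed.

Lemma jetE {R : realType} {n m} k (f : 'rV[R]_n -> 'rV[R]_m) a v :
  jet k f a v = \sum_(j < k.+1) 1 ^+ j *: (j`!%:R^-1 *: dir_iter j v f a).
Proof. by apply: eq_bigr => j _; rewrite expr1n scale1r. Qed.

(** * Flatness along Z *)

Lemma dist_le {R : realType} {n} (x a : 'rV[R]_n) (Z : set 'rV[R]_n) :
  Z a -> dist Num.norm x Z <= `|x - a|.
Proof.
move=> Za; rewrite /dist asboolF; last by move=> Z0; rewrite Z0 in Za.
by apply: ge_inf; [exists 0 => _ [y _ <-]|exists a].
Qed.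

Lemma dist_lower {R : realType} {n} (N : 'rV[R]_n -> R) (x : 'rV[R]_n)
    (Z : set 'rV[R]_n) c :
  Z 0 -> (forall a, Z a -> c <= N (x - a)) -> c <= dist N x Z.
Proof.
move=> Z0 cN; rewrite /dist asboolF; last by move=> Ze; rewrite Ze in Z0.
by apply: lb_le_inf; [exists (N (x - 0)); exists 0|move=> _ [a /cN ? <-]].
Qed.

Lemma dist_ge0 {R : realType} {n} (x : 'rV[R]_n) (Z : set 'rV[R]_n) :
  Z 0 -> 0 <= dist Num.norm x Z.
Proof. by move=> Z0; apply: dist_lower => // a _; exact: normr_ge0. Qed.

Lemma dist_triangle {R : realType} {n} (Z : set 'rV[R]_n) (x y : 'rV[R]_n) :
  Z 0 -> dist Num.norm x Z <= dist Num.norm y Z + `|x - y|.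
Proof.
move=> Z0; rewrite -lerBlDr; apply: dist_lower => // a Za.
rewrite lerBlDr (le_trans (dist_le x Za))// [leRHS]addrC.
by have := ler_normD (x - y) (y - a); rewrite subrKA.
Qed.

Lemma dist_approx {R : realType} {n} (x : 'rV[R]_n) (Z : set 'rV[R]_n) eta :
  Z 0 -> 0 < eta -> exists a, Z a /\ `|x - a| < dist Num.norm x Z + eta.
Proof.
move=> Z0 eta0; rewrite /dist asboolF; last by move=> Ze; rewrite Ze in Z0.
have [|_ [a Za <-] h] := @inf_adherent R [set `|x - y| | y in Z] _ eta0.
  by split; [exists `|x - 0|; exists 0|exists 0 => _ [y _ <-]].
by exists a.
Qed.

(** Evaluating a polynomial at [k + 1] points of [[0, 1]] determines its
    coefficient of degree one, by invertibility of a Vandermonde matrix. *)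
Lemma linear_coef_bound {R : realType} (k : nat) : (0 < k)%N ->
  exists C : R, 0 <= C /\ forall n (a : nat -> 'rV[R]_n) M,
    (forall s : R, 0 <= s <= 1 -> `|\sum_(j < k.+1) s ^+ j *: a j| <= M) ->
    `|a 1%N| <= C * M.
Proof.
move=> k0; pose node := \row_(j < k.+1) (j%:R / k.+1%:R : R).
pose V := Vandermonde k.+1 node.
have k1 : k.+1%:R != 0 :> R by rewrite pnatr_eq0.
have Vu : V \in unitmx.
  rewrite unitmxE det_Vandermonde unitfE.
  apply/prodf_neq0 => i _; apply/prodf_neq0 => j ij; rewrite !mxE.
  rewrite -mulrBl mulf_neq0 ?invr_neq0// subr_eq0 eqr_nat.
  by rewrite eq_sym neq_ltn ij.
have k1' : (1 < k.+1)%N by [].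
pose one := Ordinal k1'.
pose c := invmx V *m delta_mx one (ord0 : 'I_1).
exists (\sum_(l < k.+1) `|c l ord0|); split; first exact: sumr_ge0.
move=> n a M aM.
have -> : a 1%N = \sum_(l < k.+1) c l ord0 *:
    \sum_(j < k.+1) (node ord0 l) ^+ j *: a j.
  under eq_bigr do rewrite scaler_sumr.
  rewrite exchange_big /=.
  transitivity (\sum_(j < k.+1) ((V *m c) j ord0) *: a j).
    rewrite /c mulKVmx// (bigD1 one)//= big1 ?addr0.
      by rewrite mxE !eqxx scale1r.
    by move=> j /negbTE j1; rewrite mxE j1 scale0r.
  apply: eq_bigr => j _; rewrite mxE scaler_suml; apply: eq_bigr => l _.
  by rewrite scalerA !mxE mulrC.
rewrite (le_trans (ler_norm_sum _ _ _))// mulr_suml; apply: ler_sum => l _.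
rewrite normrZ ler_wpM2l// aM// mxE divr_ge0//= ler_pdivrMr ?ltr0n//.
by rewrite mul1r ler_nat ltnW.
Qed.

(** If the [k]-jets of [g] vanish along [Z], Taylor's formula at a point of [Z]
    almost nearest to [x] has only its remainder left. *)
Lemma flat_value {R : realType} {n m} k (U Z : set 'rV[R]_n)
    (g : 'rV[R]_n -> 'rV[R]_m) e : (0 < k)%N ->
  open U -> U 0 -> class_C k U g -> Z 0 ->
  (\forall a \near (0 : 'rV[R]_n), Z a -> forall v, jet k g a v = 0) -> 0 < e ->
  \forall x \near (0 : 'rV[R]_n), `|g x| <= e * dist Num.norm x Z ^+ k.
Proof.
move=> k0 Uo U0 gC Z0 gjet e0.
pose e1 := e / 2 / 2 ^+ k.
have e10 : 0 < e1 by rewrite !divr_gt0 ?exprn_gt0.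
have nearU := open_nbhs_nbhs (conj Uo U0).
have nearD := dir_iter_near Uo U0 gC e10.
have /nbhs_norm0P[r /= r0 rP] : \forall x \near (0 : 'rV[R]_n),
    (U x /\ (Z x -> forall v, jet k g x v = 0)) /\
    forall v, `|dir_iter k v g x - dir_iter k v g 0| <= e1 * `|v| ^+ k.
  exact: filterI (filterI nearU gjet) nearD.
have r30 : 0 < r / 3 by rewrite divr_gt0.
have far x eta : `|x| < r / 3 -> 0 < eta -> eta < r / 3 ->
    `|g x| <= 2 * e1 * (dist Num.norm x Z + eta) ^+ k.
  move=> xr eta0 etar; have [a [Za xa]] := dist_approx x Z0 eta0.
  have dx := dist_le x Z0; rewrite subr0 in dx.
  have ar : `|a| < r.
    by have := ler_normB x (x - a); rewrite opprB addrC subrK; lra.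
  have segr (s : R) : 0 <= s <= 1 -> `|a + s *: (x - a)| < r.
    move=> /andP[s0 s1].
    have -> : a + s *: (x - a) = (1 - s) *: a + s *: x.
      by rewrite scalerBr scalerBl scale1r addrA addrAC.
    rewrite (le_lt_trans (ler_normD _ _))// !normrZ ger0_norm ?subr_ge0//.
    rewrite ger0_norm//.
    have : s * `|x| <= s * (r / 3) by rewrite ler_wpM2l// ltW.
    have : (1 - s) * `|a| <= (1 - s) * r by rewrite ler_wpM2l ?subr_ge0// ltW.
    have [->|sn] := eqVneq s 0; first by rewrite subr0 !mul1r !mul0r => *; lra.
    have : 0 < s * r by rewrite mulr_gt0// lt_neqAle eq_sym sn.
    by lra.
  have := taylor_segment (x := a) (v := x - a) (M := 2 * e1 * `|x - a| ^+ k) Uo gC.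
  move=> /(_ _ _ 1); rewrite scale1r [a + _]addrC subrK -jetE.
  rewrite (rP a ar).1.2// subr0 ler01 lexx => h; apply: (le_trans (h _ _ isT)).
  - by move=> s s01; have [[]] := rP _ (segr s s01).
  - move=> s s01; have [_ h1] := rP _ (segr s s01); have [_ h2] := rP _ ar.
    have := h1 (x - a); have := h2 (x - a); rewrite distrC => {}h1 {}h2.
    rewrite -(subrKA (dir_iter k (x - a) g 0)) (le_trans (ler_normD _ _))//.
    by rewrite [`|dir_iter k (x - a) g 0 - _|]distrC in h1 *; lra.
  - have e10' := ltW e10; have xa' := ltW xa; apply: ler_wpM2l; first exact: mulr_ge0.
    by apply: lerXn2r => //; rewrite nnegrE ?normr_ge0 ?(le_trans (normr_ge0 _) xa').
apply/nbhs_norm0P; exists (r / 3) => // x xr.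
(* A point of [Z] at distance less than [2 * d x] does if [d x] is positive, the
   constant [e1] absorbing [2 ^+ k]; otherwise let [eta] tend to [0]. *)
have [d0|] := ltP 0 (dist Num.norm x Z).
- have dx := dist_le x Z0; rewrite subr0 in dx.
  apply: (le_trans (far x _ xr d0 (le_lt_trans dx xr))).
  have -> : dist Num.norm x Z + dist Num.norm x Z = 2 * dist Num.norm x Z by ring.
  rewrite exprMn /e1.
  have p2 : (2 : R) ^+ k != 0 by rewrite expf_neq0.
  by rewrite le_eqVlt; apply/orP; left; apply/eqP; field.
- have d0 := dist_ge0 x Z0 => d0'; have -> : dist Num.norm x Z = 0 by apply/eqP; rewrite eq_le d0'.
  rewrite expr0n eqn0Ngt k0 mulr0.
  apply/ler_addgt0Pl => eps eps0; rewrite addr0.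
  pose eta := Num.min (r / 6) (Num.min 1 (eps / (2 * e1))).
  have ee : 0 < eps / (2 * e1) by rewrite divr_gt0// mulr_gt0.
  have eta0 : 0 < eta by rewrite !lt_min ltr01 ee divr_gt0.
  have etar : eta < r / 3 by rewrite gt_min; apply/orP; left; lra.
  have := far x _ xr eta0 etar.
  have -> : dist Num.norm x Z = 0 by apply/eqP; rewrite eq_le d0'.
  rewrite add0r => /le_trans; apply.
  apply: (@le_trans _ _ (2 * e1 * eta)).
    have etak : eta ^+ k <= eta.
      rewrite -{1}(prednK k0) exprS ler_piMr ?(ltW eta0)// exprn_ile1 ?(ltW eta0)//.
      by rewrite /eta !ge_min lexx orbT.
    by apply: ler_wpM2l => //; rewrite mulr_ge0// ltW.
  rewrite mulrC -ler_pdivlMr ?mulr_gt0// /eta !ge_min lexx !orbT//.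
Qed.

(** [g] is small on the whole segment from [x] in the direction [u], of length
    the distance to [Z]; so is then its Taylor polynomial at [x], and with it the
    coefficient of degree one. This avoids comparing mixed derivatives. *)
Lemma flat_derivative {R : realType} {n m} k (U Z : set 'rV[R]_n)
    (g : 'rV[R]_n -> 'rV[R]_m) e : (0 < k)%N ->
  open U -> U 0 -> class_C k U g -> Z 0 ->
  (\forall a \near (0 : 'rV[R]_n), Z a -> forall v, jet k g a v = 0) -> 0 < e ->
  \forall x \near (0 : 'rV[R]_n), 0 < dist Num.norm x Z ->
    forall u, `|u| <= 1 -> `|'d g x u| <= e * dist Num.norm x Z ^+ k.-1.
Proof.
move=> k0 Uo U0 gC Z0 gjet e0.
have [C [C0 CP]] := @linear_coef_bound R k k0.
have C1 : 0 < C + 1 by rewrite ltr_wpDl.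
(* [e1] bounds the values of [g], at distance up to [2 * d] from [Z], and [e2] the
   remainder; together they leave [e / (C + 1) * d ^+ k] for the polynomial. *)
pose e1 := e / (C + 1) / 2 / 2 ^+ k.
pose e2 := e / (C + 1) / 4.
have e10 : 0 < e1 by rewrite !divr_gt0 ?exprn_gt0.
have e20 : 0 < e2 by rewrite !divr_gt0.
have nearU := open_nbhs_nbhs (conj Uo U0).
have nearD := dir_iter_near Uo U0 gC e20.
have nearG := flat_value k0 Uo U0 gC Z0 gjet e10.
have /nbhs_norm0P[r /= r0 rP] : \forall x \near (0 : 'rV[R]_n),
    (U x /\ `|g x| <= e1 * dist Num.norm x Z ^+ k) /\
    forall v, `|dir_iter k v g x - dir_iter k v g 0| <= e2 * `|v| ^+ k.
  exact: filterI (filterI nearU nearG) nearD.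
apply/nbhs_norm0P; exists (r / 2); first exact: divr_gt0.
move=> x /= xr; set d := dist Num.norm x Z => d0 u u1.
have dx := dist_le x Z0; rewrite subr0 -/d in dx.
have dk0 : 0 <= d ^+ k by rewrite exprn_ge0// ltW.
pose v := d *: u.
have vd : `|v| <= d by rewrite normrZ (gtr0_norm d0) ler_piMr// ltW.
have vk : `|v| ^+ k <= d ^+ k by apply: lerXn2r => //; rewrite nnegrE ?normr_ge0 ?(ltW d0).
have sv (s : R) : 0 <= s <= 1 -> `|s *: v| <= d.
  by move=> /andP[s0 s1]; rewrite normrZ ger0_norm// (le_trans _ vd)// ler_piMl.
have seg (s : R) : 0 <= s <= 1 -> `|x + s *: v| < r.
  by move=> s01; rewrite (le_lt_trans (ler_normD _ _))//; have := sv s s01; lra.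
have taylor (s : R) : 0 <= s <= 1 -> `|g (x + s *: v) -
    \sum_(j < k.+1) s ^+ j *: (j`!%:R^-1 *: dir_iter j v g x)| <= 2 * e2 * d ^+ k.
  move=> s01; apply: (taylor_segment Uo gC) s01 => t t01.
    by have [[]] := rP _ (seg t t01).
  have h0 : `|x + 0 *: v| < r by apply: seg; rewrite lexx ler01.
  have [_ /(_ v) h1] := rP _ (seg t t01); have [_ /(_ v) h2] := rP _ h0.
  rewrite scale0r addr0 in h2.
  rewrite -(subrKA (dir_iter k v g 0)) (le_trans (ler_normD _ _))//.
  rewrite [`|dir_iter k v g 0 - _|]distrC.
  by have : e2 * `|v| ^+ k <= e2 * d ^+ k; [rewrite ler_wpM2l// ltW|lra].
have small (s : R) : 0 <= s <= 1 ->
    `|\sum_(j < k.+1) s ^+ j *: (j`!%:R^-1 *: dir_iter j v g x)| <=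
    e / (C + 1) * d ^+ k.
  move=> s01; have := taylor s s01; have [[_ gs] _] := rP _ (seg s s01).
  set P := \sum_(j < _) _ => h.
  rewrite -[P](subKr (g (x + s *: v))) (le_trans (ler_normB _ _))//.
  have ds : dist Num.norm (x + s *: v) Z <= 2 * d.
    rewrite (le_trans (dist_triangle _ x Z0))//.
    have -> : x + s *: v - x = s *: v by rewrite addrC addKr.
    rewrite -/d.
    by have := sv s s01; lra.
  have gs' : `|g (x + s *: v)| <= e1 * (2 * d) ^+ k.
    apply: (le_trans gs); apply: ler_wpM2l; first exact: ltW.
    by apply: lerXn2r => //; rewrite nnegrE ?dist_ge0// mulr_ge0// ltW.
  have : e1 * (2 * d) ^+ k = e / (C + 1) / 2 * d ^+ k.
    have p2 : (2 : R) ^+ k != 0 by rewrite expf_neq0.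
    by rewrite exprMn /e1; field; rewrite p2 gt_eqF.
  have : 2 * e2 * d ^+ k = e / (C + 1) / 2 * d ^+ k by rewrite /e2; field; rewrite gt_eqF.
  by move=> E1 E2; rewrite E1 in h; rewrite E2 in gs'; lra.
have := CP m (fun j => j`!%:R^-1 *: dir_iter j v g x) _ small.
rewrite (_ : 1`!%:R = 1)// invr1 scale1r /=.
have gD : differentiable g x.
  have xr' : `|x| < r by lra.
  have [[Ux _] _] := rP x xr'.
  by move: gC; rewrite -(prednK k0) => -[gD _]; exact: gD.
rewrite (deriveE v gD) /v linearZ normrZ (gtr0_norm d0) => h.
rewrite -(ler_pM2l d0) (le_trans h)//.
rewrite [leRHS]mulrCA -exprS prednK// mulrA ler_wpM2r//.
by rewrite mulrA ler_pdivrMr// mulrC ler_pM2l// lerDl.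
Qed.

(** * The Rabier function and the Gram matrix *)

Lemma is_norm0 {R : realType} {n} (N : 'rV[R]_n -> R) : is_norm N -> N 0 = 0.
Proof. by move=> NN; rewrite -(scale0r 0) (is_norm_scale NN) normr0 mul0r. Qed.

Lemma is_norm_ge0 {R : realType} {n} (N : 'rV[R]_n -> R) x : is_norm N -> 0 <= N x.
Proof.
move=> NN; have := is_norm_triangle NN x (- x).
rewrite subrr (is_norm0 NN) -scaleN1r (is_norm_scale NN) normrN1 mul1r; lra.
Qed.

Lemma is_norm_upper {R : realType} {n} (N : 'rV[R]_n -> R) : is_norm N ->
  exists c, 0 < c /\ forall x, N x <= c * `|x|.
Proof.
move=> NN; have e0 i := is_norm_ge0 (delta_mx 0 i) NN.
exists (1 + \sum_i N (delta_mx 0 i)); split; first by rewrite ltr_wpDr// sumr_ge0.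
move=> x; have Nsum (s : seq 'I_n) :
    N (\sum_(i <- s) x 0 i *: delta_mx 0 i) <= \sum_(i <- s) `|x| * N (delta_mx 0 i).
  elim: s => [|i s IH]; first by rewrite !big_nil is_norm0.
  rewrite !big_cons (le_trans (is_norm_triangle NN _ _))// lerD//.
  by rewrite (is_norm_scale NN) ler_wpM2r// coord_le_norm.
rewrite {1}(row_sum_delta x) (le_trans (Nsum _))// -mulr_sumr mulrC.
by rewrite ler_wpM2r// lerDr.
Qed.

Lemma is_norm_lower {R : realType} {n} (N : 'rV[R]_n -> R) : is_norm N ->
  exists c, 0 < c /\ forall x, c * `|x| <= N x.
Proof.
move=> NN; have [c [c0 Nc]] := is_norm_upper NN.
pose S := [set x : 'rV[R]_n | `|x| = 1].
have normS x : x != 0 -> S (`|x|^-1 *: x).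
  by move=> x0; rewrite /S /= normrZ normfV normr_id mulVf// normr_eq0.
have Ncont : continuous N.
  move=> x; apply: (@locally_lipschitz_continuous R _ R).
  apply: (@lipschitz_locally R _ R _ c); first exact: ltW.
  move=> q r; apply: le_trans (Nc (q - r)).
  have := is_norm_triangle NN (q - r) r; have := is_norm_triangle NN (r - q) q.
  rewrite !subrK -[r - q]opprB -scaleN1r (is_norm_scale NN) normrN1 mul1r.
  by move=> ? ?; rewrite ler_norml; apply/andP; split; lra.
have Sc : compact S.
  apply: bounded_closed_compact.
    exists 1; split; first exact: num_real.
    by move=> M M1 x /= ->; exact: ltW.
  apply: (@preimage_closed _ _ (Num.norm : 'rV[R]_n -> R) [set y | y = 1]).
    by move=> x _; exact: norm_continuous.
  exact: closed_eq.
have [S0|] := pselect (S !=set0).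
- have [y yS ymin] := EVT_min_rV S0 Sc (continuous_subspaceT Ncont).
  rewrite inE in yS.
  have Ny : 0 < N y.
    rewrite lt_neqAle is_norm_ge0// andbT; apply/eqP => /esym/(is_norm_eq0 NN) y0.
    by move: yS; rewrite /S /= y0 normr0 => /eqP; rewrite eq_sym oner_eq0.
  exists (N y); split=> // x; have [->|x0] := eqVneq x 0.
    by rewrite normr0 mulr0 is_norm0.
  have := ymin (`|x|^-1 *: x); rewrite inE => /(_ (normS x x0)).
  rewrite (is_norm_scale NN) normfV normr_id mulrC => h.
  by rewrite -ler_pdivlMr ?normr_gt0.
- move=> S0; exists 1; split=> // x; have [->|x0] := eqVneq x 0.
    by rewrite normr0 mulr0 is_norm0.
  by case: S0; exists (`|x|^-1 *: x); exact: normS.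
Qed.

Lemma le_dual_norm {R : realType} {n} (N : 'rV[R]_n -> R) (psi : 'rV[R]_n -> R) c B x :
  0 < c -> (forall x, c * `|x| <= N x) -> (forall x, `|psi x| <= B * `|x|) -> 0 <= B ->
  N x <= 1 -> `|psi x| <= dual_norm N psi.
Proof.
move=> c0 cN psiB B0 x1; apply: ub_le_sup; last by exists x.
exists (B / c) => _ [y /= y1 <-]; apply: (le_trans (psiB y)).
by rewrite ler_wpM2l// -[leRHS]mul1r ler_pdivlMr// mulrC (le_trans (cN y)).
Qed.

Lemma dual_norm_le {R : realType} {n} (N : 'rV[R]_n -> R) (psi : 'rV[R]_n -> R) B :
  is_norm N -> (forall x, N x <= 1 -> `|psi x| <= B) -> dual_norm N psi <= B.
Proof.
move=> NN psiB; apply: ge_sup; last by move=> _ [y /= y1 <-]; exact: psiB.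
by exists `|psi 0|; exists 0 => //=; rewrite is_norm0.
Qed.

Lemma dual_norm_ge0 {R : realType} {n} (N : 'rV[R]_n -> R) (psi : 'rV[R]_n -> R) :
  0 <= dual_norm N psi.
Proof.
rewrite /dual_norm; set E := [set _ | _ in _].
have [[[y [x Nx xy]] Eub]|Eout] := pselect (has_sup E); last by rewrite sup_out.
apply: (le_trans (normr_ge0 (psi x))); apply: ub_le_sup => //.
by exists x.
Qed.

Definition linear_form {R : realType} {m} (p : 'cV[R]_m) (y : 'rV[R]_m) : R :=
  (y *m p) 0 0.

Lemma linear_form_is_linear {R : realType} {m} (p : 'cV[R]_m) :
  scalar (linear_form p).
Proof. by move=> a x y; rewrite /linear_form mulmxDl -scalemxAl !mxE. Qed.

HB.instance Definition _ (R : realType) m (p : 'cV[R]_m) :=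
  GRing.isLinear.Build R 'rV[R]_m R _ (linear_form p) (linear_form_is_linear p).

Lemma dot_norm_le {R : realType} {m} (x : 'rV[R]_m) (p : 'cV[R]_m) :
  `|(x *m p) 0 0| <= m%:R * `|x| * `|p|.
Proof.
rewrite mxE (le_trans (ler_norm_sum _ _ _))//.
apply: (@le_trans _ _ (\sum_(i < m) `|x| * `|p|)).
  by apply: ler_sum => i _; rewrite normrM ler_pM// coord_le_norm.
by rewrite sumr_const card_ord -[leLHS]mulr_natl mulrA.
Qed.

Lemma linear_formZ {R : realType} {m} (c : R) (p : 'cV[R]_m) y :
  linear_form (c *: p) y = c * linear_form p y.
Proof. by rewrite /linear_form -scalemxAr mxE. Qed.

(** The Rabier function measures how far the transpose of [A] is from having a
    kernel: here the estimate is freed from the norms defining it. *)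
Lemma rabier_lower {R : realType} {n m} (Nn : 'rV[R]_n -> R) (Nm : 'rV[R]_m -> R) :
  is_norm Nn -> is_norm Nm -> exists K, 0 < K /\
  forall (A : {linear 'rV[R]_n -> 'rV[R]_m}) c, 0 <= c -> c <= rabier Nn Nm A ->
  forall p : 'cV[R]_m, c * K * `|p| <= `|lin1_mx A *m p|.
Proof.
move=> NNn NNm.
have [a [a0 aNn]] := is_norm_lower NNn; have [b [b0 bNm]] := is_norm_lower NNm.
have [B [B0 NmB]] := is_norm_upper NNm.
have n0 : 0 < n.+1%:R :> R by rewrite ltr0n.
exists (a / (B * n.+1%:R)); split; first by rewrite divr_gt0// mulr_gt0.
move=> A c c0 cA p; set Mp := lin1_mx A *m p.
have formB (q : 'cV[R]_m) (y : 'rV[R]_m) : `|linear_form q y| <= (m%:R * `|q|) * `|y|.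
  by rewrite [leRHS]mulrAC /linear_form; exact: dot_norm_le.
have q0 (q : 'cV[R]_m) : 0 <= m%:R * `|q| by rewrite mulr_ge0.
have form_le (q : 'cV[R]_m) (y : 'rV[R]_m) := @le_dual_norm R m Nm (linear_form q) b _ y b0 bNm (formB q) (q0 q).
set s := dual_norm Nm (linear_form p).
have ps : `|p| <= B * s.
  have s0 : 0 <= s.
    by apply: le_trans (form_le p 0 _); rewrite ?(is_norm0 NNm) ?ler01.
  apply: norm_le_coord => [|i j]; first by rewrite mulr_ge0// ltW.
  rewrite ord1 mulrC -ler_pdivrMr//.
  have := form_le p (B^-1 *: delta_mx 0 i); rewrite (is_norm_scale NNm) => h.
  have -> : `|p i 0| / B = `|linear_form p (B^-1 *: delta_mx 0 i)|.
    rewrite /linear_form -scalemxAl mxE -rowE mxE normrM mulrC ger0_norm//.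
    by rewrite invr_ge0 ltW.
  apply: h; rewrite ger0_norm ?invr_ge0 ?(ltW B0)// mulrC ler_pdivrMr// mul1r.
  rewrite (le_trans (NmB _))// ler_piMr ?(ltW B0)//.
  by apply: norm_le_coord => // k l; rewrite mxE; case: (_ && _); rewrite ?normr1 ?normr0 ?ler01.
have [->|p0] := eqVneq p 0; first by rewrite normr0 mulr0.
have s0 : 0 < s.
  by rewrite -(pmulr_rgt0 _ B0) (lt_le_trans _ ps)// normr_gt0.
have unit_form : dual_norm Nm (linear_form (s^-1 *: p)) = 1.
  apply/eqP; rewrite eq_le; apply/andP; split.
    apply: dual_norm_le => // y y1; rewrite linear_formZ normrM ger0_norm ?invr_ge0 ?(ltW s0)//.
    by rewrite mulrC ler_pdivrMr// mul1r form_le.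
  rewrite -(ler_pM2l s0) mulr1; apply: dual_norm_le => // y y1.
  have := form_le (s^-1 *: p) y y1; rewrite -(ler_pM2l s0).
  by rewrite linear_formZ normrM ger0_norm ?invr_ge0 ?(ltW s0)// mulVKf// gt_eqF.
have : c <= n%:R * `|Mp| / a / s.
  apply: (le_trans cA); rewrite /rabier.
  apply: (@le_trans _ _ (dual_norm Nn (linear_form (s^-1 *: p) \o A))).
    apply: ge_inf; last by exists (linear_form (s^-1 *: p)).
    by exists 0 => _ [phi _ <-]; exact: dual_norm_ge0.
  apply: dual_norm_le => // y y1; rewrite /= linear_formZ normrM.
  rewrite ger0_norm ?invr_ge0 ?(ltW s0)// mulrC ler_wpM2r ?invr_ge0 ?(ltW s0)//.
  have -> : linear_form p (A y) = (y *m Mp) 0 0.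
    by rewrite /linear_form /Mp mulmxA mul_rV_lin1.
  rewrite (le_trans (dot_norm_le _ _))// mulrAC ler_wpM2l ?mulr_ge0//.
  by rewrite -[leRHS]mul1r ler_pdivlMr// mulrC (le_trans (aNn y)).
move=> cs; have : c * s <= n%:R * `|Mp| / a by rewrite -ler_pdivlMr.
rewrite ler_pdivlMr// => {}cs.
rewrite mulrA mulrAC ler_pdivrMr ?mulr_gt0//.
apply: (@le_trans _ _ (c * a * (B * s))); first by rewrite ler_wpM2l// mulr_ge0// ltW.
have -> : c * a * (B * s) = B * (c * s * a) by ring.
rewrite [leRHS]mulrCA ler_pM2l// (le_trans cs)// mulrC ler_wpM2l//.
by rewrite ler_nat.
Qed.

Lemma sq_norm_le {R : realType} {n} (w : 'cV[R]_n) : `|w| ^+ 2 <= (w^T *m w) 0 0.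
Proof.
have sqE : (w^T *m w) 0 0 = \sum_i w i 0 ^+ 2.
  by rewrite mxE; apply: eq_bigr => i _; rewrite mxE.
have sq0 : 0 <= (w^T *m w) 0 0 by rewrite sqE sumr_ge0// => i _; exact: sqr_ge0.
rewrite -[leRHS]sqr_sqrtr//; apply: lerXn2r; rewrite ?nnegrE ?sqrtr_ge0//.
apply: norm_le_coord; first exact: sqrtr_ge0.
move=> i j; rewrite ord1 -sqrtr_sqr ler_wsqrtr// sqE (bigD1 i)//= lerDl.
by rewrite sumr_ge0// => k _; exact: sqr_ge0.
Qed.

(** [h *m invmx (M^T *m M) *m M^T] is the solution of least Euclidean norm of
    [x *m M = h]. Setting [q := invmx (M^T *m M) *m h^T], its transpose is
    [M *m q], whose squared Euclidean norm is the product of [q^T] and [h^T]. *)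
Lemma gram_solution {R : realType} {n m} (M : 'M[R]_(n, m)) (a : R) :
  0 < a -> (forall p : 'cV[R]_m, a * `|p| <= `|M *m p|) ->
  M^T *m M \in unitmx /\ forall h : 'rV[R]_m,
    h *m invmx (M^T *m M) *m M^T *m M = h /\
    `|h *m invmx (M^T *m M) *m M^T| <= m%:R / a * `|h|.
Proof.
move=> a0 aM; set G := M^T *m M.
have GT : G^T = G by rewrite /G trmx_mul trmxK.
have Gu : G \in unitmx.
  rewrite -row_free_unit -kermx_eq0; apply/rowV0P => u /sub_kermxP uG.
  have Mu : `|M *m u^T| = 0.
    apply/eqP; rewrite -sqrf_eq0 eq_le sqr_ge0 andbT (le_trans (sq_norm_le _))//.
    by rewrite trmx_mul trmxK mulmxA -[u *m M^T *m M]mulmxA -/G uG mul0mx mxE.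
  have := aM u^T; rewrite Mu => u0.
  have {}u0 : `|u^T| <= 0 by rewrite -(ler_pM2l a0) mulr0.
  have uT0 : u^T = 0 by apply/eqP; rewrite -normr_le0.
  by rewrite -[u]trmxK uT0 trmx0.
split=> // h; split; first by rewrite -mulmxA -/G mulmxKV.
set q := invmx G *m h^T.
have E : h *m invmx G *m M^T = (M *m q)^T.
  by rewrite /q !trmx_mul trmxK trmx_inv GT.
have normT k l (P : 'M[R]_(k, l)) : `|P^T| <= `|P|.
  by apply: norm_le_coord => // i j; rewrite mxE coord_le_norm.
rewrite E (le_trans (normT _ _ _))//.
have [->|Mq] := eqVneq `|M *m q| 0; first by rewrite mulr_ge0// divr_ge0// ltW.
have Mq0 : 0 < `|M *m q| by rewrite lt_neqAle eq_sym Mq normr_ge0.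
rewrite -(ler_pM2r Mq0) -expr2 (le_trans (sq_norm_le _))//.
rewrite -E mulmxA -[_ *m M^T *m M]mulmxA -/G mulmxKV//.
apply: (le_trans (ler_norm _)); apply: (le_trans (dot_norm_le h q)).
apply: (@le_trans _ _ (m%:R * `|h| * (`|M *m q| / a))).
  by rewrite ler_wpM2l ?mulr_ge0// ler_pdivlMr// mulrC aM.
by rewrite le_eqVlt; apply/orP; left; apply/eqP; ring.
Qed.

(** * Lipschitz dependence of matrices and of C^1 maps *)

Lemma locally_lipschitz_fst {R : realType} {V W : normedModType R} (f : V -> W)
    (p : V * R) : locally_lipschitz_at f p.1 ->
  locally_lipschitz_at (fun q : V * R => f q.1) p.
Proof.
move=> [K [A [K0 pA fK]]]; exists K, [set q | A q.1]; split=> //.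
  exact: (@cvg_fst _ _ (nbhs p.1) (nbhs p.2) _ _ pA).
move=> q r Aq Ar; apply: (le_trans (fK _ _ Aq Ar)); rewrite ler_wpM2l//.
by rewrite [leRHS]/Num.Def.normr /= le_max lexx.
Qed.

Lemma class_C_locally_lipschitz {R : realType} {n m k} (U : set 'rV[R]_n)
    (g : 'rV[R]_n -> 'rV[R]_m) x : open U -> U x -> class_C k.+1 U g ->
  locally_lipschitz_at g x.
Proof.
move=> Uo Ux [gD gC].
have dgx : \forall y \near x, forall i : 'I_n,
    `|'d g y (delta_mx 0 i)| <= `|'d g x (delta_mx 0 i)| + 1.
  apply: (@filter_forall _ _ _ (nbhs x) _) => i.
  apply: (cvgr_norm_le _ (class_C_continuous (gC (delta_mx 0 i)) Ux)).
  by rewrite ltrDl.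
have /nbhs_normP[r /= r0 rP] : \forall y \near x, U y /\ forall i : 'I_n,
    `|'d g y (delta_mx 0 i)| <= `|'d g x (delta_mx 0 i)| + 1.
  exact: filterI (open_nbhs_nbhs (conj Uo Ux)) dgx.
pose K := \sum_i (`|'d g x (delta_mx 0 i)| + 1).
have K0 : 0 <= K by apply: sumr_ge0 => i _; rewrite addr_ge0.
exists K, [set y | `|x - y| < r]; split=> //.
  by apply/nbhs_ballP; exists r => //= y; rewrite -ball_normE.
move=> q s /= qr sr.
have seg (t : R) : 0 <= t <= 1 -> `|x - (s + t *: (q - s))| < r.
  move=> /andP[t0 t1].
  have -> : x - (s + t *: (q - s)) = (1 - t) *: (x - s) + t *: (x - q).
    apply/rowP => j; rewrite !mxE; ring.
  rewrite (le_lt_trans (ler_normD _ _))// !normrZ ger0_norm ?subr_ge0// ger0_norm//.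
  have [->|tn] := eqVneq t 0; first by rewrite subr0 mul1r mul0r addr0.
  have t0' : 0 < t by rewrite lt_neqAle eq_sym tn.
  have : t * `|x - q| < t * r by rewrite ltr_pM2l.
  have : (1 - t) * `|x - s| <= (1 - t) * r by rewrite ler_wpM2l ?subr_ge0// ltW.
  lra.
have := @mean_value_inequality R m (fun t => g (s + t *: (q - s)))
  (fun t => 'd g (s + t *: (q - s)) (q - s))
  (fun t => (K * `|q - s|) * t) (fun=> K * `|q - s|) 0 1 ler01.
rewrite scale1r scale0r addr0 [s + _]addrC subrK mulr1 mulr0 subr0; apply.
- move=> t t01; have [Ut _] := rP _ (seg t t01).
  exact: (@curve_chain_rule R _ _ g (fun t : R => s + t *: (q - s)) _ t (gD _ Ut)
    (is_derive_line s (q - s) t)).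
- move=> t _; have -> : (fun t => K * `|q - s| * t) = (K * `|q - s|) *: id by apply/funext.
  by apply: is_derive_eq; rewrite /GRing.scale/= mulr1.
- move=> t t01; have [_ dgt] := rP _ (seg t t01).
  rewrite linear_coord_sum (le_trans (ler_norm_sum _ _ _))// mulr_suml.
  apply: ler_sum => i _; rewrite normrZ mulrC; apply: ler_pM => //.
  exact: coord_le_norm.
Qed.

Lemma locally_lipschitz_mulmx {R : realType} {V : normedModType R} {m n l}
    (A : V -> 'M[R]_(m, n)) (B : V -> 'M[R]_(n, l)) p :
  locally_lipschitz_at A p -> locally_lipschitz_at B p ->
  locally_lipschitz_at (fun q => A q *m B q) p.
Proof.
move=> Ap Bp; apply: locally_lipschitz_mx => i j.
apply: (@locally_lipschitz_local R V R (fun q => \sum_k A q i k *: B q k j)).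
  by near=> q; rewrite mxE.
apply: (@locally_lipschitz_sum R V R) => k _.
by apply: (@locally_lipschitzZ R V R); exact: locally_lipschitz_coord.
Unshelve. all: by end_near. Qed.

Lemma locally_lipschitz_det {R : realType} {V : normedModType R} {n}
    (A : V -> 'M[R]_n) p :
  locally_lipschitz_at A p -> locally_lipschitz_at (fun q => \det (A q)) p.
Proof.
move=> Ap; apply: (@locally_lipschitz_local R V R
  (fun q => \sum_(s : 'S_n) ((-1) ^+ s : R) *: \prod_i A q i (s i))).
  by near=> q.
apply: (@locally_lipschitz_sum R V R) => s _.
apply: (@locally_lipschitzZ R V R (fun=> (-1) ^+ s)).
  exact: (@locally_lipschitz_cst R V R).
by apply: locally_lipschitz_prod => i _; exact: locally_lipschitz_coord.
Unshelve. all: by end_near. Qed.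

Lemma locally_lipschitz_adj {R : realType} {V : normedModType R} {n}
    (A : V -> 'M[R]_n) p :
  locally_lipschitz_at A p -> locally_lipschitz_at (fun q => \adj (A q)) p.
Proof.
move=> Ap; apply: locally_lipschitz_mx => i j.
apply: (@locally_lipschitz_local R V R
  (fun q => (-1) ^+ (j + i) *: \det (row' j (col' i (A q))))).
  by near=> q; rewrite mxE /cofactor.
apply: (@locally_lipschitzZ R V R (fun=> (-1) ^+ (j + i))).
  exact: (@locally_lipschitz_cst R V R).
apply: locally_lipschitz_det; apply: locally_lipschitz_mx => k l.
apply: (@locally_lipschitz_local R V R (fun q => A q (lift j k) (lift i l))).
  by near=> q; rewrite !mxE.
exact: locally_lipschitz_coord.
Unshelve. all: by end_near. Qed.

Lemma locally_lipschitz_tr {R : realType} {V : normedModType R} {m n}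
    (A : V -> 'M[R]_(m, n)) p :
  locally_lipschitz_at A p -> locally_lipschitz_at (fun q => (A q)^T) p.
Proof.
move=> Ap; apply: locally_lipschitz_mx => i j.
apply: (@locally_lipschitz_local R V R (fun q => A q j i)).
  by near=> q; rewrite mxE.
exact: locally_lipschitz_coord.
Unshelve. all: by end_near. Qed.

Lemma is_derive_scale {R : realType} {m n} (p : R -> R) (w : R -> 'M[R]_(m, n))
    (dp t : R) (dw : 'M[R]_(m, n)) :
  is_derive t 1 p dp -> is_derive t 1 w dw ->
  is_derive t 1 (fun s => p s *: w s) (dp *: w t + p t *: dw).
Proof.
move=> pD wD; apply: is_derive_mx => i j.
have wijD := is_derive_coord i j wD.
have -> : (fun s => (p s *: w s) i j) = p * (fun s => w s i j).
  by apply/funext => s; rewrite mxE.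
by apply: is_derive_eq; rewrite !mxE /GRing.scale /= addrC [dp * _]mulrC.
Qed.

(** * The Kuo vector field *)

Lemma jet_lin {R : realType} {n m k} (U : set 'rV[R]_n) (c : R)
    (f g : 'rV[R]_n -> 'rV[R]_m) a v : open U -> U a ->
  class_C k U f -> class_C k U g ->
  jet k (c *: f + g) a v = c *: jet k f a v + jet k g a v.
Proof.
move=> Uo Ua fC gC; rewrite !jetE scaler_sumr -big_split /=; apply: eq_bigr => j _.
have jk : (j <= k)%N by rewrite -ltnS.
rewrite (dir_iter_lin v c Uo jk fC gC Ua) !expr1n !scale1r scalerDr !scalerA.
by congr (_ *: _ + _); rewrite mulrC.
Qed.

(** The matrix of [d(F + t h)(x)] acting on row vectors. Clamping the time makes
    the lower bounds known for times in [[0, 1]] valid for all times. *)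
Definition deformation_mx {R : realType} {n m} (F h : 'rV[R]_n -> 'rV[R]_m)
    (p : 'rV[R]_n * R) : 'M[R]_(n, m) :=
  lin1_mx ('d F (p.1)) + unit_clamp p.2 *: lin1_mx ('d h (p.1)).

(** The least solution [v] of [d(F + t h)(x) v = - h x], with the inverse of the
    Gram matrix spelled out so as to be a rational function of its entries. *)
Definition kuo_vector {R : realType} {n m} (F h : 'rV[R]_n -> 'rV[R]_m)
    (p : 'rV[R]_n * R) : 'rV[R]_n :=
  let M := deformation_mx F h p in
  let G := M^T *m M in
  - (h p.1 *m ((\det G)^-1 *: \adj G) *m M^T).

(** The cutoff factor vanishes from radius [2 * r] on; the test at radius [3 * r]
    therefore creates no discontinuity, and discards the points where the Gram
    matrix could be singular. *)
Definition kuo_field {R : realType} {n m} (Z : set 'rV[R]_n)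
    (F h : 'rV[R]_n -> 'rV[R]_m) (r : R) (p : 'rV[R]_n * R) : 'rV[R]_n :=
  if (0 < dist Num.norm p.1 Z) && (`|p.1| < 3 * r)
  then unit_clamp (2 - `|p.1| / r) *: kuo_vector F h p else 0.

Lemma mul_deformation_mx {R : realType} {n m} (F h : 'rV[R]_n -> 'rV[R]_m) x
    (t : R) (v : 'rV[R]_n) : 0 <= t <= 1 ->
  v *m deformation_mx F h (x, t) = 'd F x v + t *: 'd h x v.
Proof.
move=> t01; rewrite /deformation_mx /= (unit_clamp_id t01) mulmxDr -scalemxAr.
by congr (_ + _ *: _); exact: mul_rV_lin1.
Qed.

Lemma kuo_vectorP {R : realType} {n m} (F h : 'rV[R]_n -> 'rV[R]_m) p (a : R) :
  0 < a -> (forall q : 'cV[R]_m, a * `|q| <= `|deformation_mx F h p *m q|) ->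
  [/\ \det ((deformation_mx F h p)^T *m deformation_mx F h p) != 0,
      kuo_vector F h p *m deformation_mx F h p = - h p.1 &
      `|kuo_vector F h p| <= m%:R / a * `|h p.1|].
Proof.
move=> a0 aM; have [Gu GP] := gram_solution a0 aM.
have [GE Gle] := GP (h p.1).
rewrite /kuo_vector /=; set M := deformation_mx F h p in Gu GE Gle *.
have -> : (\det (M^T *m M))^-1 *: \adj (M^T *m M) = invmx (M^T *m M).
  by rewrite /invmx Gu.
split; first by rewrite -unitfE -unitmxE.
- by rewrite mulNmx GE.
- by rewrite normrN.
Qed.

Lemma kuo_vector_locally_lipschitz {R : realType} {n m k} (U : set 'rV[R]_n)
    (F h : 'rV[R]_n -> 'rV[R]_m) p : open U -> U p.1 ->
  class_C k.+2 U F -> class_C k.+2 U h ->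
  \det ((deformation_mx F h p)^T *m deformation_mx F h p) != 0 ->
  locally_lipschitz_at (kuo_vector F h) p.
Proof.
move=> Uo Up FC hC det0.
have diff_lip (g : 'rV[R]_n -> 'rV[R]_m) : class_C k.+2 U g ->
    locally_lipschitz_at (fun q : 'rV[R]_n * R => lin1_mx ('d g (q.1))) p.
  move=> [_ gC]; apply: locally_lipschitz_mx => i j.
  apply: (@locally_lipschitz_local R _ R (fun q => 'd g (q.1) (delta_mx 0 i) 0 j)).
    by near=> q; rewrite mxE.
  apply: (locally_lipschitz_coord (f := fun q : 'rV[R]_n * R => 'd g (q.1) (delta_mx 0 i))).
  apply: (locally_lipschitz_fst (f := fun x => 'd g x (delta_mx 0 i))).
  exact: class_C_locally_lipschitz Uo Up (gC (delta_mx 0 i)).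
have Mp : locally_lipschitz_at (deformation_mx F h) p.
  apply: locally_lipschitzD; first exact: diff_lip.
  apply: (locally_lipschitzZ (f := fun q : 'rV[R]_n * R => unit_clamp q.2));
    last exact: diff_lip.
  apply: (@lipschitz_locally R _ R _ 1) => // q r; rewrite mul1r.
  apply: (le_trans (unit_clamp_lipschitz _ _)).
  by rewrite [leRHS]/Num.Def.normr /= le_max lexx orbT.
have Gp : locally_lipschitz_at
    (fun q => (deformation_mx F h q)^T *m deformation_mx F h q) p.
  by apply: locally_lipschitz_mulmx => //; exact: locally_lipschitz_tr.
have hp : locally_lipschitz_at (fun q : 'rV[R]_n * R => h q.1) p.
  by apply: locally_lipschitz_fst; exact: class_C_locally_lipschitz Uo Up hC.
have Wp : locally_lipschitz_at (fun q : 'rV[R]_n * R => h q.1 *m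
    ((\det ((deformation_mx F h q)^T *m deformation_mx F h q))^-1 *:
      \adj ((deformation_mx F h q)^T *m deformation_mx F h q)) *m
    (deformation_mx F h q)^T) p.
  apply: locally_lipschitz_mulmx; last exact: locally_lipschitz_tr.
  apply: locally_lipschitz_mulmx => //.
  apply: locally_lipschitzZ; last exact: locally_lipschitz_adj.
  by apply: locally_lipschitzV => //; exact: locally_lipschitz_det.
apply: (locally_lipschitz_local _
  (locally_lipschitzZ (locally_lipschitz_cst (-1 : R) p) Wp)).
by near=> q; rewrite scaleN1r.
Unshelve. all: by end_near. Qed.

Lemma kuo_field_tame {R : realType} {n m k} (U Z : set 'rV[R]_n)
    (F h : 'rV[R]_n -> 'rV[R]_m) (r : R) : open U -> Z 0 -> 0 < r ->
  class_C k.+2 U F -> class_C k.+2 U h ->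
  (forall x, `|x| < 4 * r -> U x) ->
  (forall x, `|x| < 4 * r -> 0 < dist Num.norm x Z -> forall t : R,
     \det ((deformation_mx F h (x, t))^T *m deformation_mx F h (x, t)) != 0 /\
     `|kuo_vector F h (x, t)| <= dist Num.norm x Z / 4) ->
  tame_field (fun x => dist Num.norm x Z) (kuo_field Z F h r) (2 * r).
Proof.
move=> Uo Z0 r0 FC hC rU rP.
have dD x y := @dist_triangle R n Z x y Z0.
have rho0 (x : 'rV[R]_n) : 2 * r <= `|x| -> unit_clamp (2 - `|x| / r) = 0.
  move=> xr; have x2 : 2 - `|x| / r <= 0 by rewrite subr_le0 ler_pdivlMr.
  by rewrite /unit_clamp min_r ?max_l// (le_trans x2).
have X0 p : 2 * r <= `|p.1| -> kuo_field Z F h r p = 0.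
  by move=> /rho0 p0; rewrite /kuo_field p0 scale0r if_same.
have d1c : continuous (fun p : 'rV[R]_n * R => dist Num.norm p.1 Z).
  move=> q; apply: (@continuous_comp _ _ _ fst (fun x => dist Num.norm x Z)).
    exact: cvg_fst.
  exact: distance_continuous.
have n1c : continuous (fun p : 'rV[R]_n * R => `|p.1|).
  move=> q; apply: (@continuous_comp _ _ _ fst (Num.norm : 'rV[R]_n -> R)).
    exact: cvg_fst.
  exact: norm_continuous.
split=> //.
- by move=> x; exact: dist_ge0.
- move=> p; have d0 := dist_ge0 p.1 Z0; rewrite /kuo_field.
  case: ifPn => [/andP[dp pr]|_]; last by rewrite normr0 divr_ge0.
  have /andP[c0 c1] := unit_clamp_itv (2 - `|p.1| / r).
  have pr4 : `|p.1| < 4 * r by lra.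
  have [_ le4] := rP _ pr4 dp p.2; rewrite -surjective_pairing in le4.
  by rewrite normrZ ger0_norm// (le_trans _ le4)// ler_piMl.
- move=> p dp; have [pr|pr] := ltP `|p.1| (3 * r).
    have pr4 : `|p.1| < 4 * r by lra.
    have [det0 _] := rP _ pr4 dp p.2; rewrite -surjective_pairing in det0.
    have Vp := kuo_vector_locally_lipschitz Uo (rU _ pr4) FC hC det0.
    have cp : locally_lipschitz_at
        (fun q : 'rV[R]_n * R => unit_clamp (2 - `|q.1| / r)) p.
      have ri0 : 0 <= r^-1 by rewrite invr_ge0 ltW.
      apply: (@lipschitz_locally R _ R _ r^-1) => // q s.
      apply: (le_trans (unit_clamp_lipschitz _ _)).
      have -> : 2 - `|q.1| / r - (2 - `|s.1| / r) = r^-1 * (`|s.1| - `|q.1|) by ring.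
      rewrite normrM ger0_norm// ler_wpM2l//.
      rewrite (le_trans (ler_dist_dist _ _))// distrC.
      by rewrite [leRHS]/Num.Def.normr /= le_max lexx.
    apply: (locally_lipschitz_local _ (locally_lipschitzZ cp Vp)).
    have dq : \forall q \near p, 0 < dist Num.norm q.1 Z by exact: (cvgr_gt _ (d1c p)).
    have qr : \forall q \near p, `|q.1| < 3 * r by exact: (cvgr_lt _ (n1c p)).
    near=> q; rewrite /kuo_field (_ : _ && _ = true)//.
    by apply/andP; split; near: q.
  apply: (locally_lipschitz_local _ (locally_lipschitz_cst 0 p)).
  have qr : \forall q \near p, 2 * r < `|q.1|.
    by apply: (cvgr_gt _ (n1c p)); lra.
  by apply: filterS qr => q /ltW /X0.
Unshelve. all: by end_near. Qed.

(** * Isotopies that trivialize a deformation *)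

(** Trajectories of the Kuo field keep [F + t h] constant, as
    [d(F + t h)(x) (X (x, t)) + h x = 0]; where [dist x Z] vanishes both terms
    do. *)
Lemma deformation_isotopy {R : realType} {n m k} (U Z : set 'rV[R]_n)
    (F h : 'rV[R]_n -> 'rV[R]_m) (a : R) : open U -> U 0 -> Z 0 -> 0 < a ->
  class_C k.+2 U F -> class_C k.+2 U h ->
  (\forall x \near (0 : 'rV[R]_n), 0 < dist Num.norm x Z ->
     forall (t : R) (q : 'cV[R]_m), 0 <= t <= 1 ->
     a * dist Num.norm x Z ^+ k.+1 * `|q| <=
       `|(lin1_mx ('d F x) + t *: lin1_mx ('d h x)) *m q|) ->
  (forall e, 0 < e -> \forall x \near (0 : 'rV[R]_n),
     `|h x| <= e * dist Num.norm x Z ^+ k.+2) ->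
  exists (H : 'rV[R]_n * R -> 'rV[R]_n) (psi : R -> 'rV[R]_n -> 'rV[R]_n) (r : R),
  [/\ 0 < r,
      {within setT `*` `[0, 1]%classic, continuous H} /\
      (forall x, H (x, 0) = x),
      forall (t : R) x, 0 <= t <= 1 -> Z x -> H (x, t) = x,
      forall t : R, 0 <= t <= 1 ->
        [/\ continuous (fun x => H (x, t)), continuous (psi t),
            cancel (fun x => H (x, t)) (psi t) & cancel (psi t) (fun x => H (x, t))]
    & forall x (t : R), `|x| < r -> 0 <= t <= 1 ->
        U (H (x, t)) /\ F (H (x, t)) + t *: h (H (x, t)) = F x].
Proof.
move=> Uo U0 Z0 a0 FC hC aM hsmall.
pose d x := dist Num.norm x Z.
(* Chosen for the norm of the Kuo vector to be at most [d x / 4]. *)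
have m40 : 0 < 4 * m.+1%:R :> R by rewrite mulr_gt0// ltr0n.
have e0 : 0 < a / (4 * m.+1%:R) by exact: divr_gt0.
have /nbhs_norm0P[s /= s0 sP] : \forall x \near (0 : 'rV[R]_n),
    (U x /\ `|h x| <= a / (4 * m.+1%:R) * d x ^+ k.+2) /\
    (0 < d x -> forall (t : R) (q : 'cV[R]_m), 0 <= t <= 1 ->
     a * d x ^+ k.+1 * `|q| <= `|(lin1_mx ('d F x) + t *: lin1_mx ('d h x)) *m q|).
  exact: filterI (filterI (open_nbhs_nbhs (conj Uo U0)) (hsmall _ e0)) aM.
pose r := s / 4; have r0 : 0 < r by exact: divr_gt0.
have rs : 4 * r = s by rewrite /r; field.
have good x (t : R) : `|x| < 4 * r -> 0 < d x ->
    [/\ \det ((deformation_mx F h (x, t))^T *m deformation_mx F h (x, t)) != 0,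
        kuo_vector F h (x, t) *m deformation_mx F h (x, t) = - h x &
        `|kuo_vector F h (x, t)| <= d x / 4].
  rewrite rs => xs dx; have [[_ hx] Mx] := sP x xs.
  have dk0 : 0 < d x ^+ k.+1 by rewrite exprn_gt0.
  have adk0 : 0 < a * d x ^+ k.+1 by exact: mulr_gt0.
  have [//|det0 VM Vle] := @kuo_vectorP R n m F h (x, t) _ adk0.
    by move=> q; apply: Mx => //; exact: unit_clamp_itv.
  split=> //; apply: (le_trans Vle) => /=.
  apply: (@le_trans _ _ (m%:R / (a * d x ^+ k.+1) * (a / (4 * m.+1%:R) * d x ^+ k.+2))).
    by rewrite ler_wpM2l// divr_ge0// ltW.
  have -> : m%:R / (a * d x ^+ k.+1) * (a / (4 * m.+1%:R) * d x ^+ k.+2) =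
      m%:R / m.+1%:R * (d x / 4).
    have cancelE (c b M D y : R) : b != 0 -> M != 0 -> D != 0 ->
        c / (b * D) * (b / (4 * M) * (y * D)) = c / M * (y / 4).
      by move=> b0 M0 D0; field; rewrite b0 M0 D0.
    by rewrite [d x ^+ k.+2]exprS cancelE// gt_eqF// ltr0n.
  rewrite ler_piMl// ?divr_ge0 ?(ltW dx)//.
  by rewrite ler_pdivrMr ?ltr0n// mul1r ler_nat.
pose X := kuo_field Z F h r.
have tX : tame_field d X (2 * r).
  apply: (kuo_field_tame Uo Z0 r0 FC hC) => [x|x xr dx t]; last by have [] := good x t xr dx.
  by rewrite rs => /sP[[]].
have [Phi PhiP] := tame_flow tX.
have z01 : (0 : R) <= (0 : R) <= (1 : R) by rewrite lexx ler01.
have [Phi0 PhiI Phid Phic Phicc] := PhiP 0 z01.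
(* Trajectories from points of norm less than [r / 2] stay where the cutoff factor
   is [1]. *)
exists (fun p => Phi 0 p.1 p.2), (fun t y => Phi t y 0), (r / 2).
split; first exact: divr_gt0.
- by split=> // x; have [] := Phi0 x.
- move=> t x t01 Zx /=; apply/eqP; rewrite -subr_eq0 -normr_le0.
  rewrite (le_trans (Phid x t t01))//.
  have := dist_le x Zx; rewrite subrr normr0 -/(d x); lra.
- move=> t t01; have [_ PhitI _ Phitc _] := PhiP t t01.
  split; [exact: Phic|exact: Phitc|by move=> x; exact: PhiI|].
  by move=> y; exact: PhitI.
move=> x t xr t01 /=; have [Px PX] := Phi0 x; set u := Phi 0 x in Px PX *.
have dx := dist_le x Z0; rewrite subr0 -/(d x) in dx.
have u2 (v : R) : 0 <= v <= 1 -> `|u v| < r.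
  move=> v01; have := Phid x v v01; rewrite -/u -/(d x) => h1.
  by have := ler_normD (u v - x) x; rewrite subrK; lra.
have uU (v : R) : 0 <= v <= 1 -> U (u v).
  by move=> v01; have [|[]//] := sP (u v); rewrite /= -rs; have := u2 v v01; lra.
split; first exact: uU.
have FhD (v : R) : 0 <= v <= 1 -> is_derive v 1 (fun v => F (u v) + v *: h (u v)) 0.
  move=> v01; have uv := PX v v01; have Uv := uU v v01.
  have FD := curve_chain_rule (FC.1 _ Uv) uv.
  have hD := curve_chain_rule (hC.1 _ Uv) uv.
  have vhD := is_derive_scale (is_derive_id v 1) hD.
  apply: (is_derive_eq (is_deriveD FD vhD)).
  have uv4 : `|u v| < 4 * r by have := u2 v v01; lra.
  have [du|du] := ltP 0 (d (u v)).
    have [_ VM _] := good (u v) v uv4 du.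
    have -> : X (u v, v) = kuo_vector F h (u v, v).
      have uv3 : `|u v| < 3 * r by have := u2 v v01; lra.
      rewrite /X /kuo_field /= -/(d (u v)) du uv3 /= /unit_clamp min_l.
        by rewrite max_r ?scale1r.
      by rewrite lerBrDr -lerBrDl ler_pdivrMr// (_ : 2 - 1 = 1 :> R) ?mul1r ?(ltW (u2 v v01))//; lra.
    move: (kuo_vector F h (u v, v)) VM => V VM.
    have cancel_h (A B c : 'rV[R]_m) : A + v *: B = - c -> A + (1 *: c + v *: B) = 0.
      by move=> AB; rewrite scale1r addrCA AB subrr.
    apply: cancel_h.
    exact: (etrans (esym (mul_deformation_mx F h (u v) V v01)) VM).
  have du0 : d (u v) = 0 by apply/eqP; rewrite eq_le du dist_ge0.
  have -> : X (u v, v) = 0.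
    by apply/eqP; rewrite -normr_le0 (le_trans (tame_le tX _))//= du0 mul0r.
  have -> : h (u v) = 0.
    apply/eqP; rewrite -normr_le0; rewrite rs in uv4; have [[_ hle] _] := sP _ uv4.
    by rewrite (le_trans hle)// du0 expr0n mulr0.
  have sum0 (A B : 'rV[R]_m) : A = 0 -> B = 0 -> A + (1 *: 0 + v *: B) = 0.
    by move=> -> ->; rewrite !scaler0 !addr0.
  by apply: sum0; exact: linear0.
have /andP[t0 t1] := t01.
have := @mean_value_inequality R m (fun v => F (u v) + v *: h (u v)) (fun=> 0)
  (fun=> 0) (fun=> 0) 0 t t0.
rewrite Px scale0r addr0 subrr => h0.
apply/eqP; rewrite -subr_eq0 -normr_le0; apply: h0.
- by move=> v /andP[v0 vt]; apply: FhD; rewrite v0 (le_trans vt).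
- by move=> v _; rewrite normr0.
Qed.

(** * Realisations of one jet *)

Lemma mul_lin1_mx_le {R : realType} {n m} (L : {linear 'rV[R]_n -> 'rV[R]_m})
    (B : R) : (forall u, `|u| <= 1 -> `|L u| <= B) ->
  forall q : 'cV[R]_m, `|lin1_mx L *m q| <= m%:R * B * `|q|.
Proof.
move=> LB q; have B0 : 0 <= B.
  by apply: le_trans (LB 0 _); rewrite ?normr0 ?ler01.
apply: norm_le_coord => [|i j]; first by rewrite !mulr_ge0.
rewrite mxE (le_trans (ler_norm_sum _ _ _))//.
apply: (@le_trans _ _ (\sum_(l < m) B * `|q|)); last first.
  by rewrite sumr_const card_ord -[leLHS]mulr_natl mulrA.
apply: ler_sum => l _; rewrite normrM mxE; apply: ler_pM => //; last exact: coord_le_norm.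
apply: (le_trans (coord_le_norm _ _ _)); apply: LB.
by apply: norm_le_coord => // a b; rewrite mxE; case: (_ && _); rewrite ?normr1 ?normr0 ?ler01.
Qed.

Lemma lin1_mx_split {R : realType} {n m} (L1 L2 L3 : {linear 'rV[R]_n -> 'rV[R]_m}) :
  (forall u, L3 u = -1 *: L1 u + L2 u) -> lin1_mx L2 = lin1_mx L1 + lin1_mx L3.
Proof. by move=> L3E; apply/matrixP => i j; rewrite !mxE L3E !mxE; ring. Qed.

Lemma perturbed_lower {R : realType} {n m} (Mf Mg Mh M1 : 'M[R]_(n, m))
    (q : 'cV[R]_m) (t alpha beta : R) :
  M1 = Mf + Mg -> 0 <= t <= 1 ->
  alpha <= `|Mf *m q| -> `|Mg *m q| <= beta -> `|Mh *m q| <= beta ->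
  alpha - beta - beta <= `|(M1 + t *: Mh) *m q|.
Proof.
move=> -> /andP[t0 t1] fq gq hq; rewrite !mulmxDl -scalemxAl.
move: (Mf *m q) (Mg *m q) (Mh *m q) fq gq hq => A B D fq gq hq.
have tD : `|t *: D| <= `|D| by rewrite normrZ ger0_norm// ler_piMl.
have := ler_normB (A + B + t *: D) (t *: D); rewrite addrK.
have := ler_normB (A + B) B; rewrite addrK; lra.
Qed.

(** Realisations of one jet: [f1 - f] and [f2 - f1] are flat along [Z], and flat
    perturbations do not destroy the lower bound given by the Rabier function. *)
Lemma realisations_isotopy {R : realType} {n m k : nat}
    (Nn : 'rV[R]_n -> R) (Nm : 'rV[R]_m -> R) (f f1 f2 : Ck0 R k.+2 n m)
    (Z : set 'rV[R]_n) (C : R) :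
  is_norm Nn -> is_norm Nm -> Z 0 -> 0 < C ->
  (\forall x \near (0 : 'rV[R]_n),
     rabier Nn Nm ('d f x) >= C * dist Nn x Z ^+ k.+1) ->
  same_Zjet Z f f1 -> same_Zjet Z f f2 ->
  exists (H : 'rV[R]_n * R -> 'rV[R]_n) (psi : R -> 'rV[R]_n -> 'rV[R]_n) (r : R),
  [/\ 0 < r,
      {within setT `*` `[0, 1]%classic, continuous H} /\
      (forall x, H (x, 0) = x),
      forall (t : R) x, 0 <= t <= 1 -> Z x -> H (x, t) = x,
      forall t : R, 0 <= t <= 1 ->
        [/\ continuous (fun x => H (x, t)), continuous (psi t),
            cancel (fun x => H (x, t)) (psi t) & cancel (psi t) (fun x => H (x, t))]
    & forall x (t : R), `|x| < r -> 0 <= t <= 1 ->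
        (Ck0_dom f1 `&` Ck0_dom f2) (H (x, t)) /\
        f1 (H (x, t)) + t *: (f2 (H (x, t)) - f1 (H (x, t))) = f1 x].
Proof.
move=> NNn NNm Z0 C0 rab jet1 jet2.
pose U := Ck0_dom f `&` Ck0_dom f1 `&` Ck0_dom f2.
have Uo : open U by do 2?[apply: openI]; exact: Ck0_dom_open.
have U0 : U 0 by split; [split|]; exact: Ck0_dom0.
have nearU := open_nbhs_nbhs (conj Uo U0).
have fC : class_C k.+2 U f by apply: class_C_subset (Ck0_class f) => x [[]].
have f1C : class_C k.+2 U f1 by apply: class_C_subset (Ck0_class f1) => x [[]].
have f2C : class_C k.+2 U f2 by apply: class_C_subset (Ck0_class f2) => x [].
pose g : 'rV[R]_n -> 'rV[R]_m := -1 *: (f : _ -> _) + (f1 : _ -> _).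
pose h : 'rV[R]_n -> 'rV[R]_m := -1 *: (f1 : _ -> _) + (f2 : _ -> _).
have gC : class_C k.+2 U g by exact: class_C_lin.
have hC : class_C k.+2 U h by exact: class_C_lin.
have hE x : h x = f2 x - f1 x.
  by rewrite /h -[LHS]/(-1 *: f1 x + f2 x) scaleN1r addrC.
have gjet : \forall a \near (0 : 'rV[R]_n), Z a -> forall v, jet k.+2 g a v = 0.
  apply: filterS (filterI nearU jet1) => a [Ua fa] Za v.
  by rewrite (jet_lin (-1) v Uo Ua fC f1C) (fa Za) scaleN1r addNr.
have hjet : \forall a \near (0 : 'rV[R]_n), Z a -> forall v, jet k.+2 h a v = 0.
  apply: filterS (filterI nearU (filterI jet1 jet2)) => a [Ua [fa1 fa2]] Za v.
  by rewrite (jet_lin (-1) v Uo Ua f1C f2C) -(fa1 Za) -(fa2 Za) scaleN1r addNr.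
have [K [K0 rabK]] := rabier_lower NNn NNm.
have [c [c0 cN]] := is_norm_lower NNn.
pose b := C * c ^+ k.+1 * K.
have b0 : 0 < b by rewrite !mulr_gt0// exprn_gt0.
have m0 : 0 < m.+1%:R :> R by rewrite ltr0n.
(* Each of the two flat perturbations may cost a quarter of [b]. *)
pose e := b / (4 * m.+1%:R).
have e0 : 0 < e by rewrite divr_gt0// mulr_gt0.
have b20 : 0 < b / 2 by rewrite divr_gt0.
have gflat := flat_derivative (ltn0Sn k.+1) Uo U0 gC Z0 gjet e0.
have hflat := flat_derivative (ltn0Sn k.+1) Uo U0 hC Z0 hjet e0.
have lower : \forall x \near (0 : 'rV[R]_n), 0 < dist Num.norm x Z ->
    forall (t : R) (q : 'cV[R]_m), 0 <= t <= 1 ->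
    b / 2 * dist Num.norm x Z ^+ k.+1 * `|q| <=
      `|(lin1_mx ('d f1 x) + t *: lin1_mx ('d h x)) *m q|.
  apply: filterS (filterI (filterI nearU rab) (filterI gflat hflat)).
  move=> x [[Ux rabx] [gx hx]] dx t q t01.
  set d := dist Num.norm x Z in dx gx hx *.
  have dk0 : 0 <= d ^+ k.+1 by rewrite exprn_ge0// ltW.
  have lowf : b * d ^+ k.+1 * `|q| <= `|lin1_mx ('d f x) *m q|.
    have cd : c * d <= dist Nn x Z.
      apply: dist_lower => // a Za; apply: le_trans (cN _).
      by rewrite ler_pM2l//; exact: dist_le.
    have cd0 : 0 <= c * d by apply: mulr_ge0; exact: ltW.
    have := rabK ('d f x) (C * (c * d) ^+ k.+1) _ _ q.
    rewrite (_ : C * (c * d) ^+ k.+1 * K = b * d ^+ k.+1); last first.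
      by rewrite /b exprMn; ring.
    apply; first by apply: mulr_ge0; [exact: ltW|exact: exprn_ge0].
    apply: le_trans rabx; apply: ler_wpM2l; first exact: ltW.
    by have dd := le_trans cd0 cd; apply: lerXn2r.
  have gle := mul_lin1_mx_le (gx dx) q.
  have hle := mul_lin1_mx_le (hx dx) q.
  have f1E : lin1_mx ('d f1 x) = lin1_mx ('d f x) + lin1_mx ('d g x).
    by apply: lin1_mx_split => u; exact: diff_lin_apply (fC.1 x Ux) (f1C.1 x Ux).
  have eb : m%:R * (e * d ^+ k.+1) * `|q| <= b / 4 * d ^+ k.+1 * `|q|.
    apply: ler_wpM2r => //; rewrite mulrA; apply: ler_wpM2r => //.
    rewrite /e mulrA ler_pdivrMr; last by rewrite mulr_gt0.
    have -> : b / 4 * (4 * m.+1%:R) = m.+1%:R * b by field.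
    by apply: ler_wpM2r; [exact: ltW|rewrite ler_nat].
  have bE : b / 2 * d ^+ k.+1 * `|q| =
      b * d ^+ k.+1 * `|q| - b / 4 * d ^+ k.+1 * `|q| - b / 4 * d ^+ k.+1 * `|q| by field.
  rewrite bE.
  exact: (perturbed_lower f1E t01 lowf (le_trans gle eb) (le_trans hle eb)).
have hsmall e' : 0 < e' -> \forall x \near (0 : 'rV[R]_n),
    `|h x| <= e' * dist Num.norm x Z ^+ k.+2.
  by move=> e'0; exact: (flat_value (ltn0Sn k.+1) Uo U0 hC Z0 hjet e'0).
have [H [psi [r [r0 Hc HZ Hpsi HF]]]] :=
  deformation_isotopy Uo U0 Z0 b20 f1C hC lower hsmall.
exists H, psi, r; split=> // x t xr t01.
have [[[_ U1] U2] FE] := HF x t xr t01.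
by split; [split|rewrite -hE].
Qed.

Lemma cancel_homeo_onto_image {R : realType} {n} (phi psi : 'rV[R]_n -> 'rV[R]_n)
    (U : set 'rV[R]_n) :
  continuous phi -> continuous psi -> cancel phi psi -> cancel psi phi ->
  homeo_onto_image U phi.
Proof.
move=> phic psic phiK psiK; split; first exact: continuous_subspaceT.
by exists psi; split=> [x _|]; [exact: phiK|exact: continuous_subspaceT].
Qed.

Theorem theorem3 (R : realType) (n m k : nat)
    (Nn : 'rV[R]_n -> R) (Nm : 'rV[R]_m -> R)
    (hNn : is_norm Nn) (hNm : is_norm Nm)
    (hmn : (m <= n)%N) (hk : (1 < k)%N)
    (f : Ck0 R k n m)
    (Z : set 'rV[R]_n)
    (hZ : Z = [set x | Ck0_dom f x /\ rabier Nn Nm ('d f x) = 0])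
    (hZ0 : Z 0)
    (w : set (Ck0 R k n m)) (hw : w = Zjet Z f)
    (C : R) (hC : 0 < C)
    (hineq : \forall x \near (0 : 'rV[R]_n),
       rabier Nn Nm ('d f x) >= C * dist Nn x Z ^+ k.-1) :
  C0_Z_sufficient Z w /\
  (forall f1 f2 : Ck0 R k n m, w f1 -> w f2 ->
     topologically_trivial_near Z
       (Ck0_dom f1) f1
       (Ck0_dom f1 `&` Ck0_dom f2) (fun x => f2 x - f1 x) /\
     isotopical_near Z (Ck0_dom f1) f1 (Ck0_dom f2) f2).
Proof.
case: k => [|[|k]] // in hk f hZ w hw hineq *; rewrite {}hw {hk hmn hZ}.
have i0 : (0 : R) <= (0 : R) <= (1 : R) by rewrite lexx ler01.
have i1 : (0 : R) <= (1 : R) <= (1 : R) by rewrite lexx ler01.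
have ball_nbhs (r : R) : 0 < r -> nbhs (0 : 'rV[R]_n) [set x | `|x| < r].
  move=> r0; apply/nbhs_ballP; exists r => //= x.
  by rewrite -ball_normE /= sub0r normrN.
have isotopy (f1 f2 : Ck0 R k.+2 n m) : Zjet Z f f1 -> Zjet Z f f2 ->
  exists (H : 'rV[R]_n * R -> 'rV[R]_n) (r : R),
  [/\ 0 < r, isotopy_near Z [set x | `|x| < r] H, homeo_germ0 (fun x => H (x, 1)),
     (forall x, `|x| < r -> H (x, 0) = x) &
     forall x (t : R), `|x| < r -> 0 <= t <= 1 ->
        (Ck0_dom f1 `&` Ck0_dom f2) (H (x, t)) /\
        f1 (H (x, t)) + t *: (f2 (H (x, t)) - f1 (H (x, t))) = f1 x].
  move=> w1 w2.
  have [H [psi [r [r0 [Hc H0] HZ Hpsi HF]]]] :=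
    realisations_isotopy hNn hNm hZ0 hC hineq w1 w2.
  exists H, r; split=> //.
  - split=> //; first exact: ball_nbhs.
    + by apply: continuous_subspaceW Hc => p [_ p01].
    + by move=> t x t01 [_ Zx]; exact: HZ.
    + move=> t t01; have [h1 h2 h3 h4] := Hpsi t t01.
      exact: cancel_homeo_onto_image h1 h2 h3 h4.
  - have [h1 h2 h3 h4] := Hpsi 1 i1.
    split; first exact: HZ.
    exists setT; split=> //; first exact: openT.
      rewrite (_ : _ @` setT = setT); first exact: openT.
      by rewrite eqEsubset; split=> // y _; exists (psi 1 y) => //; exact: h4.
    exact: cancel_homeo_onto_image h1 h2 h3 h4.
(* The deformation from [f2] to [f1] gives [f1] composed with the final map equal
   to [f2], and not the reverse. *)
have isotopy_to (f1 f2 : Ck0 R k.+2 n m) : Zjet Z f f1 -> Zjet Z f f2 ->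
  exists (H : 'rV[R]_n * R -> 'rV[R]_n) (r : R),
  [/\ 0 < r, isotopy_near Z [set x | `|x| < r] H, homeo_germ0 (fun x => H (x, 1)) &
     forall x, `|x| < r -> [/\ Ck0_dom f1 x, Ck0_dom f2 x, Ck0_dom f1 (H (x, 1)) &
       f1 (H (x, 1)) = f2 x]].
  move=> w1 w2; have [H [r [r0 Hi Hg H0 HF]]] := isotopy f2 f1 w2 w1.
  exists H, r; split=> // x xr.
  have [[d2 d1] E] := HF x 1 xr i1; have [[e2 e1] _] := HF x 0 xr i0.
  rewrite H0// in e1 e2; split=> //.
  by rewrite -E scale1r addrC subrK.
split=> [f1 f2 w1 w2|f1 f2 w1 w2].
- have [H [r [r0 [_ _ _ HZ _] Hg HF]]] := isotopy_to f1 f2 w1 w2.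
  exists (fun x => H (x, 1)); split=> //.
  exists [set x | `|x| < r]; split; first exact: ball_nbhs.
  split=> [x /HF[]//|x [Zx xr]]; exact: HZ.
split.
- have [H [r [r0 Hi Hg H0 HF]]] := isotopy f1 f2 w1 w2.
  exists [set x | `|x| < r], H; split=> //.
  + by move=> x xr; have [] := HF x 0 xr i0; rewrite H0// => -[].
  + by move=> x t xr t01; have [[]] := HF x t xr t01.
  + move=> x s t xr s01 t01; have [_ ->] := HF x s xr s01.
    by have [_ ->] := HF x t xr t01.
- have [H [r [r0 Hi Hg HF]]] := isotopy_to f1 f2 w1 w2.
  exists [set x | `|x| < r], H; split=> //.
  + by move=> x /HF[].
  + by move=> x /HF[].
Qed.
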